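(* Let $\{\psi_d\}_{d\in\mathbb{N}}$ be a sequence of tests, $\psi_d:\mathbb{R}^d\to[0,1]$, with asymptotic size $\alpha\in(0,1)$, and let $\{r_d\}_{d\in\mathbb{N}}$ be a sequence of real numbers $r_d>0$ such that the sequence $r_d/d^{1/4}$ is bounded. Then there exists an $\epsilon>0$ such that for every sequence of non-empty Borel sets $\mathbb{D}_d\subseteq \mathbb{B}_2^d(r_d)$, $d\in\mathbb{N}$, satisfying $$\prod_{d=1}^{\infty}\mathbb{D}_d\subseteq \mathscr{C}(\psi_d),$$ we have $$\frac{\mathrm{vol}_d(\mathbb{D}_d)}{\mathrm{vol}_d(\mathbb{B}_2^d(r_d))}\le 2\exp\left(-\frac{\epsilon^2(d-1)}{2r_d^2}\right)\quad\text{for all } d \text{ large enough};$$ in particular, $\mathrm{vol}_d(\mathbb{D}_d)/\mathrm{vol}_d(\mathbb{B}_2^d(r_d))$ converges to $0$ as $d\to\infty$.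
   Context: Gaussian sequence model: for each $d\in\mathbb{N}$ one observes $\boldsymbol{y}_d=\boldsymbol{\theta}_d+\boldsymbol{\varepsilon}_d\in\mathbb{R}^d$, where $\boldsymbol{\theta}_d\in\mathbb{R}^d$ is an unknown parameter and $\boldsymbol{\varepsilon}_d=(\varepsilon_1,\dots,\varepsilon_d)'$ with $\varepsilon_1,\varepsilon_2,\dots$ independent standard normal random variables. The testing problem is $H_{0,d}:\boldsymbol{\theta}_d=\boldsymbol{0}_d$ against $H_{1,d}:\boldsymbol{\theta}_d\in\mathbb{R}^d\setminus\{\boldsymbol{0}_d\}$. A (possibly randomized) test $\psi_d$ is a measurable function $\psi_d:\mathbb{R}^d\to[0,1]$. A sequence of tests $\{\psi_d\}_{d\in\mathbb{N}}$ has asymptotic size $\alpha\in[0,1]$ if $\mathbb{E}(\psi_d(\boldsymbol{\varepsilon}_d))\to\alpha$ as $d\to\infty$. It is consistent against an array $\boldsymbol{\vartheta}=\{\boldsymbol{\theta}_d:d\in\mathbb{N}\}$ with $\boldsymbol{\theta}_d\in\mathbb{R}^d$ for every $d\in\mathbb{N}$ if $\mathbb{E}(\psi_d(\boldsymbol{\theta}_d+\boldsymbol{\varepsilon}_d))\to1$ as $d\to\infty$. The consistency set $\mathscr{C}(\psi_d)\subseteq\prod_{d=1}^\infty\mathbb{R}^d$ of the sequence $\{\psi_d\}_{d\in\mathbb{N}}$ (the notation refers to the whole sequence) is the set of all arrays against which the sequence is consistent. $\mathbb{B}_2^d(r)=\{x\in\mathbb{R}^d:\|x\|_2\le r\}$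 is the Euclidean ball of radius $r$ centered at the origin, $\mathrm{vol}_d$ is $d$-dimensional Lebesgue measure, and $\prod_{d=1}^\infty$ denotes the Cartesian product. *)

(* Defs.v *)
From HB Require Import structures.
From mathcomp Require Import all_boot all_order all_algebra finmap.
From mathcomp Require Import all_classical all_reals all_analysis.
Import Order.TTheory GRing.Theory Num.Theory.
Import numFieldNormedType.Exports.

Set Implicit Arguments.
Unset Strict Implicit.
Unset Printing Implicit Defensive.

Local Open Scope classical_set_scope.
Local Open Scope ring_scope.

(* R^d is d.-tuple R.  Its measurable structure is the product sigma-algebra
   generated by the coordinates, which is the Borel sigma-algebra of R^d. *)

Definition tuple_add (R : realType) d (x y : d.-tuple R) : d.-tuple R :=
  [tuple tnth x i + tnth y i | i < d].

Definition norm2 (R : realType) d (x : d.-tuple R) : R :=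
  Num.sqrt (\sum_(i < d) tnth x i ^+ 2).

Definition ball2 (R : realType) d (r : R) : set (d.-tuple R) :=
  [set x | norm2 x <= r].
Arguments ball2 {R} d r _.

Definition cons_pair (R : realType) d (p : R * d.-tuple R) : d.+1.-tuple R :=
  [tuple of p.1 :: p.2].

Lemma measurable_cons_pair (R : realType) d :
  measurable_fun setT (@cons_pair R d).
Proof.
exact: (measurable_cons measurable_fst measurable_snd).
Qed.

Lemma cons_pairK (R : realType) d :
  cancel (fun x : d.+1.-tuple R => (thead x, [tuple of behead x]))
         (@cons_pair R d).
Proof. by move=> x; rewrite [RHS]tuple_eta. Qed.

Lemma measurable_uncons (R : realType) d :
  measurable_fun setT
    (fun x : d.+1.-tuple R => (thead x, [tuple of behead x] : d.-tuple R)).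
Proof.
apply: measurable_fun_pair; last exact: measurable_behead.
exact: measurable_tnth.
Qed.

Section lebesgue_cons.
Context (R : realType) (d : nat).
Variable mu : {sigma_finite_measure set (d.-tuple R) -> \bar R}.

Definition lebesgue_cons : set (d.+1.-tuple R) -> \bar R :=
  pushforward (@lebesgue_measure R \x mu)%E (@cons_pair R d).

Let lebesgue_cons0 : lebesgue_cons set0 = 0%E.
Proof. by rewrite /lebesgue_cons /pushforward preimage_set0 measure0. Qed.

Let lebesgue_cons_ge0 A : (0 <= lebesgue_cons A)%E.
Proof. by rewrite /lebesgue_cons /pushforward; exact: measure_ge0. Qed.

Let lebesgue_cons_sigma_additive : semi_sigma_additive lebesgue_cons.
Proof.
move=> F mF tF mUF; rewrite /lebesgue_cons /pushforward preimage_bigcup.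
have mp A : measurable A -> measurable (@cons_pair R d @^-1` A).
  by move=> mA; rewrite -[X in measurable X]setTI; exact: measurable_cons_pair.
apply: measure_semi_sigma_additive.
- by move=> n; exact: mp.
- apply/trivIsetP => /= i j _ _ ij; rewrite -preimage_setI.
  by move/trivIsetP : tF => /(_ _ _ _ _ ij) ->//; rewrite preimage_set0.
- by rewrite -preimage_bigcup; exact: mp.
Qed.

HB.instance Definition _ := isMeasure.Build _ _ _ lebesgue_cons
  lebesgue_cons0 lebesgue_cons_ge0 lebesgue_cons_sigma_additive.

Let lebesgue_cons_sigma_finite : sigma_finite setT lebesgue_cons.
Proof.
have /sigma_finiteP[F [TF ndF Foo]] := sigma_finiteT (@lebesgue_measure R).
have /sigma_finiteP[G [TG ndG Goo]] := sigma_finiteT mu.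
pose u (x : d.+1.-tuple R) := (thead x, [tuple of behead x] : d.-tuple R).
have uK : cancel (@cons_pair R d) u.
  by move=> [a t]; rewrite /u /cons_pair theadE; congr pair; exact: val_inj.
exists (fun n => u @^-1` (F n `*` G n)).
  apply/esym; rewrite -subTset => x _.
  have [n _ Fx] : (\bigcup_i F i) (thead x) by rewrite -TF.
  have [k _ Gx] : (\bigcup_i G i) (u x).2 by rewrite -TG.
  exists (maxn n k) => //; split.
  - by move: Fx; exact/subsetPset/ndF/leq_maxl.
  - by move: Gx; exact/subsetPset/ndG/leq_maxr.
move=> n; have [mF Fn] := Foo n; have [mG Gn] := Goo n; split.
  rewrite -[X in measurable X]setTI; apply: measurable_uncons => //.
  exact: measurableX.
rewrite /lebesgue_cons /pushforward -comp_preimage.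
rewrite (_ : u \o _ = id); last by apply/funext => p /=; exact: uK.
by rewrite preimage_id product_measure1E// lte_mul_pinfty// ge0_fin_numE.
Qed.

HB.instance Definition _ := Measure_isSigmaFinite.Build _ _ _ lebesgue_cons
  lebesgue_cons_sigma_finite.

End lebesgue_cons.

(* vol d.+1 is the image of lebesgue_measure \x vol d under (a, t) |-> a :: t,
   and vol 0 is the unit mass on the one-point space R^0. *)
Fixpoint vol (R : realType) (d : nat) :
    {sigma_finite_measure set (d.-tuple R) -> \bar R} :=
  if d is d'.+1 then lebesgue_cons (vol R d') else dirac [tuple].
Arguments vol {R} d.

Lemma measurable_box (R : realType) d (A : 'I_d -> set R) :
  (forall i, measurable (A i)) ->
  measurable [set x : d.-tuple R | forall i, A i (tnth x i)].
Proof.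
move=> mA.
rewrite (_ : [set x | _] = \bigcap_(i in [set: 'I_d]) ((@tnth d R)^~ i @^-1` A i)).
  apply: fin_bigcap_measurable => // i _.
  by rewrite -[X in measurable X]setTI; exact: measurable_tnth.
by apply/seteqP; split => x /= h i => [_|]; exact: h.
Qed.

Lemma vol_box (R : realType) d (A : 'I_d -> set R) :
  (forall i, measurable (A i)) ->
  (vol d [set x | forall i, A i (tnth x i)] =
   \prod_(i < d) lebesgue_measure (A i))%E.
Proof.
elim: d A => [|d IH] A mA.
  rewrite big_ord0 /= diracE mem_set//=.
  by case.
pose B := [set x : d.-tuple R | forall i, A (lift ord0 i) (tnth x i)].
have E : @cons_pair R d @^-1` [set x | forall i, A i (tnth x i)] =
    A ord0 `*` B.
  apply/seteqP; split => -[a t] /=.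
  - move=> h; split=> [|i]; first exact: (h ord0).
    by have := h (lift ord0 i); rewrite /cons_pair tnthS.
  - move=> [h0 h] i; case: (unliftP ord0 i) => [j|] ->; last exact: h0.
    by rewrite /cons_pair tnthS; exact: h.
rewrite big_ord_recl -(IH (fun i => A (lift ord0 i)))//= /lebesgue_cons.
rewrite /pushforward E product_measure1E//; first exact: (mA ord0).
exact: (@measurable_box R d (fun i => A (lift ord0 i))).
Qed.

Section testing.
Context (R : realType) (dO : measure_display) (Omega : measurableType dO).
Variable P : probability Omega R.

Definition mutually_independent (X : nat -> {RV P >-> R}) : Prop :=
  forall (J : {fset nat}) (A : nat -> set R), (forall i, measurable (A i)) ->
  P (\bigcap_(i in [set` J]) (X i @^-1` A i)) =
  (\prod_(i <- J) P (X i @^-1` A i))%E.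

Definition iid_standard_normal (eps : nat -> {RV P >-> R}) : Prop :=
  mutually_independent eps /\
  forall i (A : set R), measurable A ->
    distribution P (eps i) A = normal_prob 0 1 A.

(* The sequence eps starts at index 0. *)
Definition noise (eps : nat -> {RV P >-> R}) d (w : Omega) : d.-tuple R :=
  [tuple eps i w | i < d].

Definition is_test d (psi : d.-tuple R -> R) : Prop :=
  measurable_fun setT psi /\ forall x, 0 <= psi x <= 1.

Definition has_asymptotic_size (eps : nat -> {RV P >-> R})
    (psi : forall d, d.-tuple R -> R) (alpha : R) : Prop :=
  ('E_P[fun w => psi d (noise eps d w)])%E @[d --> \oo] --> alpha%:E.

Definition consistent (eps : nat -> {RV P >-> R})
    (psi : forall d, d.-tuple R -> R) (theta : forall d, d.-tuple R) : Prop :=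
  ('E_P[fun w => psi d (tuple_add (theta d) (noise eps d w))])%E
    @[d --> \oo] --> 1%E.

Definition consistency_set (eps : nat -> {RV P >-> R})
    (psi : forall d, d.-tuple R -> R) : set (forall d, d.-tuple R) :=
  [set theta | consistent eps psi theta].

End testing.

(* Families over d >= 1 are indexed by nat with a guard 0 < d; the extra
   component in d = 0 lives in the one-point space R^0 and is unconstrained. *)
Definition product_set (R : realType) (D : forall d, set (d.-tuple R)) :
    set (forall d, d.-tuple R) :=
  [set theta | forall d, (0 < d)%N -> D d (theta d)].

(* Main.v *)
Require Import Defs.
From HB Require Import structures.
From mathcomp Require Import all_boot all_order all_algebra finmap.
From mathcomp Require Import all_classical all_reals all_analysis measurable_realfun.
From mathcomp Require Import ring lra.
Import Order.TTheory GRing.Theory Num.Theory.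
Import numFieldNormedType.Exports.
Local Open Scope classical_set_scope.
Local Open Scope ring_scope.
Set Implicit Arguments.
Unset Strict Implicit.
Unset Printing Implicit Defensive.

(** Let g = 1 - psi_d, and let G(th) be the mean of g under the normal law with
    mean th and identity covariance: the error of the second kind at th, or, at
    th = 0, one minus the size.  If G exceeded some fixed dl > 0 somewhere on
    D_d for infinitely many d, an array made of such bad points would lie in
    the product of the D_d without being consistent; so G <= dl on all of D_d
    for d large ([eventually_small_error]).  It remains to bound, for one fixed
    dimension, the volume of a subset D of the ball on which G <= dl.

    The Cauchy-Schwarz inequality for two shifted Gaussian densities gives the
    Harnack inequality G(x)^2 <= G(y) exp(|x - y|^2)
    ([gaussian_mean_harnack]): points where G is not small are far from D.  The
    Prekopa-Leindler inequality ([prekopa_leindler]), applied with the weight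
    w(x) = exp(-2m|x|^2) to the functions w G^(2m) and w 1_D, turns this into
    concentration of measure:
<<
      b^(2m) vol(D) <= dl^m exp(2m r^2) Z,    Z = the integral of w,
>>
    where b is the average of G with respect to w / Z
    ([volume_gaussian_mean_small]).

    Two facts make this bound useful.  First, b stays away from zero: averaging
    G over the Gaussian prior w / Z integrates g against another centred
    Gaussian law, with respect to which the null law has bounded second
    moment as soon as d / m^2 is bounded; Cauchy-Schwarz again bounds b below
    by G(0)^2 times a constant ([gaussian_mean0_le]).  Secondly, when
    2m r^2 = d / 2 + O(sqrt d) the ball has volume at least
    Z exp(d / 2 - O(sqrt d)) ([ball_volume_ge]), since most of the mass of
    w / Z lies in a thin shell inside the ball.  So the ratio of volumes is at
    most (dl / b^2)^m exp(O(sqrt d)).  Here m is of order d / r^2, which is at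
    least of order sqrt d because r = O(d^(1/4)): this is where that growth
    condition enters, and it serves also to bound d / m^2.  Since dl may be any
    constant, a small one absorbs exp(O(sqrt d)), and the rate of the theorem
    is reached with e = 1 ([volume_ratio_le]). *)

(** * Translations of the line and the one-dimensional Brunn-Minkowski inequality *)

Section translation.
Context {R : realType}.
Local Notation mu := (@lebesgue_measure R).

Lemma measurable_addr (c : R) : measurable_fun setT (fun x : R => x + c).
Proof. exact: measurable_funD. Qed.

Lemma lebesgue_measure_addr (c : R) (A : set R) : measurable A ->
  mu ((fun x => x + c) @^-1` A) = mu A.
Proof.
move=> mA; apply/esym.
have mf : measurable_fun [set: measurableTypeR R] (fun x : R => x + c : measurableTypeR R).
  exact: measurable_addr.
pose f : {mfun measurableTypeR R >-> measurableTypeR R} :=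
  HB.pack (fun x : R => x + c) (isMeasurableFun.Build _ _ _ _ _ mf).
have := @lebesgue_measure_unique R (pushforward mu f) _ A mA.
apply => _ [[a b] _ <-].
change (mu `]a, b] = mu ((fun x => x + c) @^-1` `]a, b])).
rewrite (_ : _ @^-1` _ = `]a - c, b - c]%classic); last first.
  by apply/seteqP; split => x /=; rewrite !in_itv/= ltrBlDr lerBrDr.
rewrite !lebesgue_measure_itv/= !lte_fin ltrD2r; case: ifP => // _.
by rewrite -!EFinB; congr EFin; ring.
Qed.

Lemma ge0_integral_addr (c : R) (f : R -> \bar R) : measurable_fun setT f ->
  (forall x, (0 <= f x)%E) -> (\int[mu]_x f (x + c)%R = \int[mu]_x f x)%E.
Proof.
move=> mf f0.
have mg : measurable_fun [set: measurableTypeR R] (fun x : R => x + c : measurableTypeR R).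
  exact: measurable_addr.
have := @ge0_integral_pushforward _ _ _ _ R _ mg mu setT f measurableT mf (fun x _ => f0 x).
rewrite preimage_setT => <-.
apply: eq_measure_integral => A mA _ /=.
exact: lebesgue_measure_addr.
Qed.
End translation.

Section brunn_minkowski.
Context {R : realType}.
Local Notation mu := (@lebesgue_measure R).
Implicit Types A B C : set R.

Lemma measurable_addr_preimage (c : R) A : measurable A ->
  measurable ((fun x => x + c) @^-1` A).
Proof. by move=> mA; rewrite -[X in measurable X]setTI; exact: measurable_addr. Qed.

(** With a in A and b in B, the sum set contains the translates (A left of a) + b and
    a + (B right of b), which lie on the two sides of a + b and so are disjoint.
    The points a and b stand in for the maximum of A and the minimum of B, which
    need not be attained. *)
Lemma brunn_minkowski_cut A B C (a b : R) : measurable A -> measurable B ->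
  measurable C -> A a -> B b ->
  (forall x y, A x -> B y -> C (x + y)) ->
  (mu (A `&` `]-oo, a[) + mu (B `&` `[b, +oo[) <= mu C)%E.
Proof.
move=> mA mB mC Aa Bb ABC.
pose A' := (fun x => x + (- b)) @^-1` (A `&` `]-oo, a[).
pose B' := (fun x => x + (- a)) @^-1` (B `&` `[b, +oo[).
have mA0 : measurable (A `&` `]-oo, a[) by apply: measurableI.
have mB0 : measurable (B `&` `[b, +oo[) by apply: measurableI.
have mA' : measurable A' by exact: measurable_addr_preimage.
have mB' : measurable B' by exact: measurable_addr_preimage.
rewrite -(lebesgue_measure_addr (- b) mA0) -(lebesgue_measure_addr (- a) mB0).
rewrite -measureU//.
  apply: le_measure; rewrite ?inE//; first exact: measurableU.
  move=> x [] [] /=.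
  - by move=> Ax _; rewrite -(subrK b x); exact: ABC.
  - by move=> Bx _; rewrite -(subrK a x) addrC; exact: ABC.
apply/seteqP; split => // x [[_ h1] [_ h2]]; move: h1 h2.
by rewrite /= !in_itv/= andbT; lra.
Qed.

(** A set bounded above loses little when it is cut at a point near its supremum:
    what is removed lies in a short interval. *)
Lemma lebesgue_cut_le A (e : R) : measurable A -> A !=set0 -> 0 < e ->
  has_ubound A -> exists2 a, A a & (mu A <= mu (A `&` `]-oo, a[) + e%:E)%E.
Proof.
move=> mA A0 e0 Aub.
have [a Aa ha] := sup_adherent e0 (conj A0 Aub).
exists a => //.
have mAa : measurable (A `&` `]-oo, a[) by exact: measurableI.
have IV : (mu `[a, sup A] <= e%:E)%E.
  rewrite lebesgue_measure_itv/=; case: ifP => _; last by rewrite lee_fin ltW.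
  by rewrite -EFinB lee_fin; lra.
apply: (@le_trans _ _ (mu ((A `&` `]-oo, a[) `|` `[a, sup A]))).
  apply: le_measure; rewrite ?inE//; first exact: measurableU.
  move=> x Ax; have [xa|ax] := ltP x a; first by left; rewrite /= in_itv.
  by right; rewrite /= in_itv/= ax/=; exact: ub_le_sup.
apply: (le_trans (measureU2 _ _ _)) => //; exact: leeD2l.
Qed.

Lemma lebesgue_cut_ge A (e : R) : measurable A -> A !=set0 -> 0 < e ->
  has_lbound A -> exists2 a, A a & (mu A <= mu (A `&` `[a, +oo[) + e%:E)%E.
Proof.
move=> mA A0 e0 Alb.
have [a Aa ha] := inf_adherent e0 (conj A0 Alb).
exists a => //.
have mAa : measurable (A `&` `[a, +oo[) by exact: measurableI.
have IV : (mu `[inf A, a] <= e%:E)%E.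
  rewrite lebesgue_measure_itv/=; case: ifP => _; last by rewrite lee_fin ltW.
  by rewrite -EFinB lee_fin; lra.
apply: (@le_trans _ _ (mu ((A `&` `[a, +oo[) `|` `[inf A, a]))).
  apply: le_measure; rewrite ?inE//; first exact: measurableU.
  move=> x Ax; have [ax|xa] := leP a x; first by left; rewrite /= in_itv/= ax.
  by right; rewrite /= in_itv/= (ltW xa) andbT; exact: ge_inf.
apply: (le_trans (measureU2 _ _ _)) => //; exact: leeD2l.
Qed.

Lemma brunn_minkowski_bounded A B C : measurable A -> measurable B ->
  measurable C -> A !=set0 -> B !=set0 -> has_ubound A -> has_lbound B ->
  (forall x y, A x -> B y -> C (x + y)) -> (mu A + mu B <= mu C)%E.
Proof.
move=> mA mB mC A0 B0 Aub Blb ABC; apply/lee_addgt0Pr => e e0.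
have e20 : 0 < e / 2 by lra.
have [a Aa Ha] := lebesgue_cut_le mA A0 e20 Aub.
have [b Bb Hb] := lebesgue_cut_ge mB B0 e20 Blb.
apply: (le_trans (leeD Ha Hb)).
rewrite addeACA -EFinD [in X in (_ + X)%E](_ : e / 2 + e / 2 = e); last by field.
by rewrite leeD2r//; exact: brunn_minkowski_cut.
Qed.

(** The unbounded case is exhausted by the intersections with growing intervals,
    centred at a point of each set so that none of them is empty. *)
Lemma brunn_minkowski A B C : measurable A -> measurable B ->
  measurable C -> A !=set0 -> B !=set0 ->
  (forall x y, A x -> B y -> C (x + y)) -> (mu A + mu B <= mu C)%E.
Proof.
move=> mA mB mC [a Aa] [b Bb] ABC.
pose T (D : set R) (c : R) (n : nat) := D `&` `[c - n%:R, c + n%:R]%classic.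
have mT D c n : measurable D -> measurable (T D c n).
  by move=> mD; exact: measurableI.
have TE D c : \bigcup_n T D c n = D.
  apply/seteqP; split => [x [n _ []//]|x Dx].
  exists (Num.bound `|x - c|) => //; split => //=.
  have := archi_boundP (normr_ge0 (x - c)).
  by rewrite ltr_norml in_itv/= => /andP[h1 h2]; apply/andP; split; lra.
have cT D c : measurable D -> mu (T D c n) @[n --> \oo] --> mu D.
  move=> mD; rewrite -[X in _ --> mu X](TE D c); apply: nondecreasing_cvg_mu.
  - by move=> n; exact: mT.
  - by apply: bigcup_measurable => n _; exact: mT.
  - move=> n m nm; apply/subsetPset => x [Dx /=]; rewrite !in_itv/= => /andP[h1 h2].
    split => //=; rewrite in_itv/=.
    have : n%:R <= m%:R :> R by rewrite ler_nat.
    by move=> h; apply/andP; split; lra.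
have Tc D c n : D c -> T D c n !=set0.
  by move=> Dc; exists c; split => //=; rewrite in_itv/= lerBlDr lerDl ler0n.
have H n : (mu (T A a n) + mu (T B b n) <= mu C)%E.
  apply: brunn_minkowski_bounded => //; try exact: mT; try exact: Tc.
  - by exists (a + n%:R) => x [_ /=]; rewrite in_itv/= => /andP[].
  - by exists (b - n%:R) => x [_ /=]; rewrite in_itv/= => /andP[].
  - by move=> x y [Ax _] [By _]; exact: ABC.
have cAB : (mu (T A a n) + mu (T B b n))%E @[n --> \oo] --> (mu A + mu B)%E.
  by apply: cvgeD; [rewrite ge0_adde_def// inE measure_ge0|exact: cT|exact: cT].
by apply: (cvge_to_le cAB); exact: nearW.
Qed.
End brunn_minkowski.

(** * The layer-cake formula and Prekopa-Leindler on the line *)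

Section layer_cake.
Context {d : measure_display} {T : measurableType d} {R : realType}.
Variable nu : {sigma_finite_measure set T -> \bar R}.
Local Notation mu := (@lebesgue_measure R).
Local Open Scope ereal_scope.
Variable u : T -> \bar R.
Hypotheses (mu_ : measurable_fun setT u) (u0 : forall x, 0 <= u x).

Let S : set (T * R) := [set p | (0 < p.2)%R /\ p.2%:E < u p.1].

Let mS : measurable S.
Proof.
rewrite (_ : S = (setT `&` [set p : T * R | (cst 0 p) < (p.2)%:E]) `&`
                 (setT `&` [set p : T * R | (p.2)%:E < u p.1])).
  apply: measurableI.
    apply: measurable_lte => //; exact/measurable_EFinP.
  apply: measurable_lte => //; first exact/measurable_EFinP.
  exact: measurableT_comp.
by rewrite !setTI; apply/seteqP; split => -[x t] /= [h1 h2]; split.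
Qed.

Let f (p : T * R) := (\1_S p)%:E : \bar R.
Let mf : measurable_fun setT f.
Proof. by apply/measurable_EFinP; exact: measurable_indic. Qed.
Let f0 p : 0 <= f p. Proof. by rewrite lee_fin. Qed.

Definition superlevel_measure (t : R) := nu [set x | (0 < t)%R /\ t%:E < u x].

Let superlevelE : superlevel_measure = fubini_G nu f.
Proof.
apply/funext => t; rewrite /fubini_G /superlevel_measure.
rewrite (_ : [set x | _] = ysection S t); last first.
  by apply/seteqP; split => x; rewrite /ysection/= in_setE.
under eq_integral => x _.
  rewrite (_ : f (x, t) = (\1_(ysection S t) x)%:E); last first.
    by rewrite /f !indicE /ysection; congr (_%:R%:E); rewrite !mem_setE.
  over.
by rewrite integral_indic ?setIT//; exact: measurable_ysection.
Qed.

Lemma measurable_superlevel_measure : measurable_fun setT superlevel_measure.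
Proof. by rewrite superlevelE; exact: measurable_fun_fubini_tonelli_G. Qed.

(** Tonelli for the indicator of the region 0 < t < u(x), whose vertical sections
    have length u(x).  The condition 0 < t is part of the superlevel set, so that
    the integral in t can run over the whole line. *)
Lemma ge0_integral_layer_cake : \int[nu]_x u x = \int[mu]_t superlevel_measure t.
Proof.
rewrite superlevelE -fubini_tonelli2// fubini_tonelli1//.
apply: eq_integral => x _; rewrite /fubini_F.
under eq_integral => t _.
  rewrite (_ : f (x, t) = (\1_(xsection S x) t)%:E); last first.
    by rewrite /f !indicE /xsection; congr (_%:R%:E); rewrite !mem_setE.
  over.
rewrite integral_indic ?setIT//; last exact: measurable_xsection.
move: (u0 x); case E : (u x) => [r| |]// r0.
  rewrite (_ : xsection S x = `]0%R, r[%classic).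
    rewrite [RHS](lebesgue_measure_itv (Interval (BRight 0%R) (BLeft r)))/=.
    rewrite lte_fin -EFinB subr0; case: ltP => // r0'.
    by apply/eqP; rewrite eq_le r0 andbT lee_fin.
  apply/seteqP; split => t; rewrite /xsection/= in_setE/= in_itv/= /S/= E lte_fin.
    by move=> [-> ->].
  by move=> /andP[].
rewrite (_ : xsection S x = `]0%R, +oo[%classic).
  by rewrite [RHS](lebesgue_measure_itv (Interval (BRight 0%R) +oo%O))/= ltry.
apply/seteqP; split => t; rewrite /xsection/= in_setE/= in_itv/= /S/= E ltry.
  by move=> [->].
by rewrite andbT => ->.
Qed.
End layer_cake.

Section prekopa_leindler1.
Context {R : realType}.
Local Notation mu := (@lebesgue_measure R).
Local Open Scope ereal_scope.
Implicit Types u v h : R -> \bar R.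

(** For functions with supremum 1, the superlevel sets at a height t < 1 are
    nonempty and the sum of those of u and v is contained in that of h, so that
    Brunn-Minkowski compares their measures; at heights t >= 1 both are empty.
    The layer-cake formula integrates this comparison over t. *)
Lemma prekopa_leindler1_normalized u v h :
  measurable_fun setT u -> measurable_fun setT v -> measurable_fun setT h ->
  (forall x, 0 <= u x <= 1) -> (forall x, 0 <= v x <= 1) -> (forall x, 0 <= h x) ->
  (forall t, (t < 1)%R -> exists x, t%:E < u x) ->
  (forall t, (t < 1)%R -> exists x, t%:E < v x) ->
  (forall x y, u x * v y <= h (x + y)%R * h (x + y)%R) ->
  \int[mu]_x u x + \int[mu]_x v x <= \int[mu]_x h x.
Proof.
move=> mu_ mv mh u01 v01 h0 supu supv uvh.
have u0 x : 0 <= u x by case/andP: (u01 x).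
have v0 x : 0 <= v x by case/andP: (v01 x).
rewrite (ge0_integral_layer_cake mu mu_)// (ge0_integral_layer_cake mu mv)//.
rewrite (ge0_integral_layer_cake mu mh)// -ge0_integralD//;
  try exact: measurable_superlevel_measure.
apply: ge0_le_integral => //.
- by move=> t _; rewrite adde_ge0.
- by apply: emeasurable_funD; exact: measurable_superlevel_measure.
- exact: measurable_superlevel_measure.
move=> t _; rewrite /superlevel_measure.
have mL (w : R -> \bar R) : measurable_fun setT w -> measurable [set x | (0 < t)%R /\ t%:E < w x].
  move=> mw; have [t0|t0] := ltP 0%R t.
    rewrite (_ : [set x | _] = setT `&` [set x | t%:E < w x]).
      exact: emeasurable_fun_o_infty.
    by rewrite setTI; apply/seteqP; split => x //= [].
  rewrite (_ : [set x | _] = set0)//.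
  by apply/seteqP; split => x /= [].
have [/andP[t0 t1]|t01] := boolP (0 < t < 1)%R.
  have t0E : 0 < t%:E by rewrite lte_fin.
  apply: brunn_minkowski; try exact: mL.
  - by have [x ux] := supu _ t1; exists x.
  - by have [x vx] := supv _ t1; exists x.
  - move=> x y [_ ux] [_ vy]; split => //.
    rewrite ltNge; apply/negP => ht.
    have : t%:E * t%:E < u x * v y.
      apply: (@lt_le_trans _ _ (u x * t%:E)); first by rewrite lte_pmul2r.
      by apply: lee_pmul => //; exact: ltW.
    by apply/negP; rewrite -leNgt (le_trans (uvh _ _))// lee_pmul.
have E0 (w : R -> \bar R) : (forall x, 0 <= w x <= 1) ->
    [set x | (0 < t)%R /\ t%:E < w x] = set0.
  move=> w01; apply/seteqP; split => x //= [t0 tw]; move: t01; rewrite t0/= => /negP; apply.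
  by rewrite -lte_fin; apply: (lt_le_trans tw); case/andP: (w01 x).
by rewrite (E0 _ u01) (E0 _ v01) measure0 adde0.
Qed.

(** Dividing u by M, v by N and h by sqrt(MN), with M and N the suprema of u and v,
    reduces to suprema equal to 1, where the integrals add up; the arithmetic-geometric
    mean inequality then yields the multiplicative form. *)
Lemma prekopa_leindler1_bounded u v h (K : R) :
  measurable_fun setT u -> measurable_fun setT v -> measurable_fun setT h ->
  (forall x, 0 <= u x <= K%:E) -> (forall x, 0 <= v x <= K%:E) -> (forall x, 0 <= h x) ->
  (forall x y, u x * v y <= h (x + y)%R * h (x + y)%R) ->
  4%:E * (\int[mu]_x u x * \int[mu]_x v x) <= \int[mu]_x h x * \int[mu]_x h x.
Proof.
move=> mu_ mv mh uK vK h0 uvh.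
have [->|Ih] := eqVneq (\int[mu]_x h x) +oo; first by rewrite mulyy leey.
have I0 (w : R -> \bar R) : (forall x, 0 <= w x) -> 0 <= \int[mu]_x w x.
  by move=> ?; exact: integral_ge0.
have u0 x : 0 <= u x by case/andP: (uK x).
have v0 x : 0 <= v x by case/andP: (vK x).
have norm (w : R -> \bar R) : measurable_fun setT w -> (forall x, 0 <= w x <= K%:E) ->
    \int[mu]_x w x != 0 -> exists2 M : R, (0 < M)%R &
    [/\ forall x, 0 <= (M^-1)%:E * w x <= 1
      & forall t, (t < 1)%R -> exists x, t%:E < (M^-1)%:E * w x].
  move=> mw wK w0.
  pose M := ereal_sup (range w).
  have wM x : w x <= M by apply: ereal_sup_ubound; exists x.
  have MK : M <= K%:E by apply: ge_ereal_sup => _ [x _ <-]; case/andP: (wK x).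
  have M0 : 0 < M.
    rewrite ltNge; apply/negP => M0; move/eqP: w0; apply.
    apply: integral0_eq => x _; apply/eqP; rewrite eq_le (le_trans (wM x) M0)/=.
    by case/andP: (wK x).
  have Mfin : M \is a fin_num by rewrite ge0_fin_numE ?(ltW M0)// (le_lt_trans MK)// ltry.
  exists (fine M); first by rewrite fine_gt0// M0/= (le_lt_trans MK)// ltry.
  have M0' : (0 < fine M)%R by rewrite fine_gt0// M0/= (le_lt_trans MK)// ltry.
  split=> [x|t t1].
    apply/andP; split.
      apply: mule_ge0; first by rewrite lee_fin invr_ge0 ltW.
      by case/andP: (wK x).
    by rewrite lee_pdivrMl// mule1 fineK.
  have e0 : (0 < (1 - t) * fine M)%R by rewrite mulr_gt0// subr_gt0.
  have [_ [x _ <-] wx] := ub_ereal_sup_adherent e0 Mfin.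
  exists x; rewrite lte_pdivlMl//; apply: le_lt_trans wx.
  rewrite -/M -[X in _ <= X - _](fineK Mfin) -EFinM -EFinB lee_fin; lra.
have [Iu|Iu] := eqVneq (\int[mu]_x u x) 0.
  by rewrite Iu mul0e mule0 mule_ge0// I0.
have [Iv|Iv] := eqVneq (\int[mu]_x v x) 0.
  by rewrite Iv !mule0 mule_ge0// I0.
have [M M0 [uM supu]] := norm _ mu_ uK Iu.
have [N N0 [vN supv]] := norm _ mv vK Iv.
pose s := Num.sqrt (M * N).
have s0 : (0 < s)%R by rewrite sqrtr_gt0 mulr_gt0.
have s2 : (s * s = M * N)%R by rewrite -expr2 sqr_sqrtr// ltW// mulr_gt0.
have := @prekopa_leindler1_normalized (fun x => (M^-1)%:E * u x)
  (fun x => (N^-1)%:E * v x) (fun x => (s^-1)%:E * h x).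
rewrite !ge0_integralZl//; try by rewrite lee_fin invr_ge0 ltW.
have Hh : forall x, 0 <= (s^-1)%:E * h x.
  by move=> x; rewrite mule_ge0// lee_fin invr_ge0 ltW.
(* The pointwise hypothesis is invariant under this rescaling as s * s = M * N. *)
have Huvh x y : (M^-1)%:E * u x * ((N^-1)%:E * v y) <=
    (s^-1)%:E * h (x + y)%R * ((s^-1)%:E * h (x + y)%R).
  rewrite (muleACA (M^-1)%:E) [X in _ <= X](muleACA (s^-1)%:E) -!EFinM -!invfM s2.
  by rewrite lee_pmul2l ?lte_fin ?invr_gt0 ?mulr_gt0.
move=> /(_ (measurable_funeM _ mu_) (measurable_funeM _ mv) (measurable_funeM _ mh)
          uM vN Hh supu supv Huvh).
have hfin : \int[mu]_x h x \is a fin_num by rewrite ge0_fin_numE ?I0// ltey.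
move=> H.
have fu : \int[mu]_x u x \is a fin_num.
  rewrite ge0_fin_numE ?I0//; case: ltP => //; rewrite leye_eq => /eqP E.
  move: H; rewrite E gt0_muley ?lte_fin ?invr_gt0//.
  rewrite addye; last by rewrite gt_eqF// (lt_le_trans ltNy0)// mule_ge0 ?I0// lee_fin invr_ge0 ltW.
  by rewrite -(fineK hfin).
have fv : \int[mu]_x v x \is a fin_num.
  rewrite ge0_fin_numE ?I0//; case: ltP => //; rewrite leye_eq => /eqP E.
  move: H; rewrite E [X in _ + X]gt0_muley ?lte_fin ?invr_gt0//.
  by rewrite -(fineK hfin) -(fineK fu).
have := I0 _ h0; have := I0 _ u0; have := I0 _ v0; move: H.
rewrite -(fineK hfin) -(fineK fu) -(fineK fv).
move: (fine (\int[mu]_x h x)) (fine (\int[mu]_x u x)) (fine (\int[mu]_x v x)) => c a b.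
rewrite -!EFinM -EFinD !lee_fin => H b0 a0 c0.
pose p := (M^-1 * a)%R; pose q := (N^-1 * b)%R; pose w := (s^-1 * c)%R.
have aE : (a = M * p)%R by rewrite /p mulVKf// gt_eqF.
have bE : (b = N * q)%R by rewrite /q mulVKf// gt_eqF.
have cE : (c = s * w)%R by rewrite /w mulVKf// gt_eqF.
have p0 : (0 <= p)%R by rewrite mulr_ge0// invr_ge0 ltW.
have q0 : (0 <= q)%R by rewrite mulr_ge0// invr_ge0 ltW.
have -> : (4 * (a * b) = s * s * (4 * p * q))%R by rewrite s2 aE bE; ring.
have -> : (c * c = s * s * (w * w))%R by rewrite cE; ring.
rewrite ler_wpM2l ?mulr_ge0 ?(ltW s0)//.
have pqw : (p + q <= w)%R by [].
have : ((p + q) * (p + q) <= w * w)%R by apply: ler_pM; rewrite ?addr_ge0.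
apply: le_trans; rewrite -subr_ge0.
by rewrite (_ : _ - _ = (p - q) ^+ 2)%R ?sqr_ge0//; ring.
Qed.
End prekopa_leindler1.

Section prekopa_leindler_1d.
Context {R : realType}.
Local Notation mu := (@lebesgue_measure R).
Local Open Scope ereal_scope.

Lemma cvg_ge0_integral_truncation (u : R -> \bar R) : measurable_fun setT u ->
  (forall x, 0 <= u x) ->
  \int[mu]_x mine (u x) n%:R%:E @[n --> \oo] --> \int[mu]_x u x.
Proof.
move=> mu_ u0.
have lim_u x : mine (u x) n%:R%:E @[n --> \oo] --> u x.
  case E : (u x) (u0 x) => [r| |]// _.
  - apply: cvg_near_cst; near=> n.
    rewrite min_l// lee_fin ltW//.
    by near: n; exact: nbhs_infty_gtr.
  - rewrite (_ : (fun n => _) = (fun n => n%:R%:E)).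
      apply/cvgenyP; exact: cvg_id.
    by apply/funext => n; rewrite min_r// leey.
rewrite (_ : \int[mu]_x u x = \int[mu]_x limn (fun n => mine (u x) n%:R%:E)).
  apply: cvg_monotone_convergence => //.
  - by move=> n; exact: measurable_mine.
  - by move=> n x _; rewrite le_min u0 lee_fin/=.
  - move=> x _ n m nm; rewrite le_min !ge_min lexx/= orbC.
    by rewrite lee_fin ler_nat nm.
by apply: eq_integral => x _; apply/esym/cvg_lim.
Unshelve. all: by end_near. Qed.

(** Truncating u and v at height n preserves the pointwise hypothesis, and monotone
    convergence recovers the integrals.  If one of them vanishes the claim is
    trivial; otherwise the product is continuous at the pair of limits, even
    infinite ones. *)
Lemma prekopa_leindler1 (u v h : R -> \bar R) :
  measurable_fun setT u -> measurable_fun setT v -> measurable_fun setT h ->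
  (forall x, 0 <= u x) -> (forall x, 0 <= v x) -> (forall x, 0 <= h x) ->
  (forall x y, u x * v y <= h (x + y)%R * h (x + y)%R) ->
  4%:E * (\int[mu]_x u x * \int[mu]_x v x) <= \int[mu]_x h x * \int[mu]_x h x.
Proof.
move=> mu_ mv mh u0 v0 h0 uvh.
have I0 (w : R -> \bar R) : (forall x, 0 <= w x) -> 0 <= \int[mu]_x w x.
  by move=> ?; exact: integral_ge0.
have [Iu|Iu] := eqVneq (\int[mu]_x u x * \int[mu]_x v x) 0.
  by rewrite Iu mule0 mule_ge0// I0.
have tr (w : R -> \bar R) n : (forall x, 0 <= w x) ->
    forall x, 0 <= mine (w x) n%:R%:E <= n%:R%:E.
  by move=> w0 x; rewrite le_min w0 lee_fin ler0n/= ge_min lexx orbT.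
have H n : 4%:E * (\int[mu]_x mine (u x) n%:R%:E * \int[mu]_x mine (v x) n%:R%:E)
    <= \int[mu]_x h x * \int[mu]_x h x.
  apply: (@prekopa_leindler1_bounded _ _ _ _ n%:R) => //.
  - exact: measurable_mine.
  - exact: measurable_mine.
  - exact: tr.
  - exact: tr.
  - move=> x y; apply: le_trans (uvh x y).
    apply: lee_pmul; rewrite ?ge_min ?lexx//.
      by have /andP[] := tr _ n u0 x.
    by have /andP[] := tr _ n v0 y.
have cl : 4%:E * (\int[mu]_x mine (u x) n%:R%:E * \int[mu]_x mine (v x) n%:R%:E)
    @[n --> \oo] --> 4%:E * (\int[mu]_x u x * \int[mu]_x v x).
  apply: cvgeZl => //.
  apply: cvgeM; first exact: neq0_mule_def.
    exact: cvg_ge0_integral_truncation.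
  exact: cvg_ge0_integral_truncation.
by apply: (cvge_to_le cl); exact: nearW.
Qed.
End prekopa_leindler_1d.

(** * Prekopa-Leindler in every dimension *)

Section vol_tonelli.
Context {R : realType}.
Local Notation mu := (@lebesgue_measure R).
Local Open Scope ereal_scope.

Lemma measurable_cons_comp d (f : d.+1.-tuple R -> \bar R) :
  measurable_fun setT f -> measurable_fun setT (f \o @cons_pair R d).
Proof. by move=> mf; apply: measurableT_comp => //; exact: measurable_cons_pair. Qed.

Lemma measurable_cons_section d (f : d.+1.-tuple R -> \bar R) x :
  measurable_fun setT f -> measurable_fun setT (fun t => f (cons_pair (x, t))).
Proof.
move=> mf; apply: (measurableT_comp (measurable_cons_comp mf)).
by apply: measurable_fun_pair.
Qed.

Lemma measurable_integral_cons d (f : d.+1.-tuple R -> \bar R) :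
  measurable_fun setT f -> (forall x, 0 <= f x) ->
  measurable_fun setT (fun x => \int[vol d]_t f (cons_pair (x, t))).
Proof.
move=> mf f0; exact: (measurable_fun_fubini_tonelli_F (m2 := vol d) _
  (measurable_cons_comp mf) (fun p => f0 _)).
Qed.

(** Tonelli in the form of a recursion on the dimension, on which the
    d-dimensional results below rest. *)
Lemma ge0_integral_vol_cons d (f : d.+1.-tuple R -> \bar R) :
  measurable_fun setT f -> (forall x, 0 <= f x) ->
  \int[vol d.+1]_x f x = \int[mu]_x \int[vol d]_t f (cons_pair (x, t)).
Proof.
move=> mf f0.
transitivity (\int[mu \x vol d]_p f (cons_pair p)).
  rewrite [LHS](@ge0_integral_pushforward _ _ (measurableTypeR R * d.-tuple R)%type
    _ R _ (@measurable_cons_pair R d))//.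
rewrite fubini_tonelli1//; exact: measurable_cons_comp.
Qed.

Lemma ge0_integral_vol0 (f : 0.-tuple R -> \bar R) :
  measurable_fun setT f -> \int[vol 0]_x f x = f [tuple].
Proof. by move=> mf; rewrite integral_dirac// diracT mul1e. Qed.

End vol_tonelli.

Section prekopa_leindler_d.
Context {R : realType}.
Local Open Scope ereal_scope.

Lemma tuple_add_cons d (x y : R) (s t : d.-tuple R) :
  tuple_add (cons_pair (x, s)) (cons_pair (y, t)) = cons_pair ((x + y)%R, tuple_add s t).
Proof.
apply: eq_from_tnth => i; rewrite tnth_mktuple.
case: (unliftP ord0 i) => [j|] ->; rewrite /cons_pair ?tnthS ?tnth0//=.
by rewrite tnth_mktuple.
Qed.

(** The form with sums, h (x + y), rather than midpoints: it needs only translations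
    of the line, and the scaling by 1/2 of the usual form becomes the factor 4^d.
    Integrating out all coordinates but the first turns the hypothesis in dimension
    d + 1 into that of the one-dimensional inequality. *)
Theorem prekopa_leindler d (u v h : d.-tuple R -> \bar R) :
  measurable_fun setT u -> measurable_fun setT v -> measurable_fun setT h ->
  (forall x, 0 <= u x) -> (forall x, 0 <= v x) -> (forall x, 0 <= h x) ->
  (forall x y, u x * v y <= h (tuple_add x y) * h (tuple_add x y)) ->
  (4 ^+ d)%:E * (\int[vol d]_x u x * \int[vol d]_x v x)
    <= \int[vol d]_x h x * \int[vol d]_x h x.
Proof.
elim: d u v h => [|d IH] u v h mu_ mv mh u0 v0 h0 uvh.
  rewrite !ge0_integral_vol0// expr0 mul1e.
  have E : tuple_add [tuple] [tuple] = [tuple] :> 0.-tuple R.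
    by apply: eq_from_tnth => -[].
  by have := uvh [tuple] [tuple]; rewrite E.
rewrite !ge0_integral_vol_cons// exprS EFinM -muleA.
pose U x := \int[vol d]_t u (cons_pair (x, t)).
pose V x := \int[vol d]_t v (cons_pair (x, t)).
pose H x := \int[vol d]_t h (cons_pair (x, t)).
have U0 x : 0 <= U x by exact: integral_ge0.
have V0 x : 0 <= V x by exact: integral_ge0.
have H0 x : 0 <= H x by exact: integral_ge0.
have mU : measurable_fun setT U by exact: measurable_integral_cons.
have mV : measurable_fun setT V by exact: measurable_integral_cons.
have mH : measurable_fun setT H by exact: measurable_integral_cons.
(* The factor 4 ^ d of the induction hypothesis is shared equally between U and V. *)
have c0 : 0 <= (2 ^+ d)%:E :> \bar R by rewrite lee_fin exprn_ge0.
have c2 : (2 ^+ d)%:E * (2 ^+ d)%:E = (4 ^+ d)%:E :> \bar R.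
  by rewrite -EFinM -exprMn; congr ((_ ^+ _)%:E); ring.
have UVH x y : (2 ^+ d)%:E * U x * ((2 ^+ d)%:E * V y) <= H (x + y)%R * H (x + y)%R.
  rewrite muleACA c2; apply: IH.
  - exact: measurable_cons_section.
  - exact: measurable_cons_section.
  - exact: measurable_cons_section.
  - by move=> t; exact: u0.
  - by move=> t; exact: v0.
  - by move=> t; exact: h0.
  - by move=> s t; rewrite -tuple_add_cons; exact: uvh.
have := prekopa_leindler1 (measurable_funeM _ mU) (measurable_funeM _ mV) mH
  (fun x => mule_ge0 c0 (U0 x)) (fun x => mule_ge0 c0 (V0 x)) H0 UVH.
by rewrite !ge0_integralZl// muleACA c2.
Qed.
End prekopa_leindler_d.

(** * Gaussian integrals on R^d *)

Section vol_product.
Context {R : realType}.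
Local Notation mu := (@lebesgue_measure R).

Lemma measurable_prod_tnth d (k : 'I_d -> R -> R) :
  (forall i, measurable_fun setT (k i)) ->
  measurable_fun setT (fun x : d.-tuple R => \prod_(i < d) k i (tnth x i)).
Proof.
move=> mk; apply: measurable_prod => i _ _.
by apply: measurableT_comp => //; exact: measurable_tnth.
Qed.

Lemma integral_vol_prod d (k : 'I_d -> R -> R) :
  (forall i, measurable_fun setT (k i)) -> (forall i x, 0 <= k i x) ->
  (\int[vol d]_x (\prod_(i < d) k i (tnth x i))%:E =
   \prod_(i < d) \int[mu]_x (k i x)%:E)%E.
Proof.
elim: d k => [|d IH] k mk k0.
  rewrite ge0_integral_vol0; first by rewrite !big_ord0.
  by apply/measurable_EFinP; exact: measurable_prod_tnth.
have mp := measurable_prod_tnth mk.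
rewrite ge0_integral_vol_cons; first last.
- by move=> x; rewrite lee_fin prodr_ge0.
- exact/measurable_EFinP.
rewrite big_ord_recl.
rewrite -(IH (fun i => k (lift ord0 i)))//.
pose J := (\int[vol d]_t (\prod_(i < d) k (lift ord0 i) (tnth t i))%:E)%E.
have E x : (\int[vol d]_t (\prod_(i < d.+1) k i (tnth (cons_pair (x, t)) i))%:E =
    (k ord0 x)%:E * J)%E.
  rewrite -ge0_integralZl//; first last.
  - by rewrite lee_fin.
  - by move=> t _; rewrite lee_fin prodr_ge0.
  - by apply/measurable_EFinP; exact: (@measurable_prod_tnth d (fun i => k (lift ord0 i))).
  apply: eq_integral => t _; rewrite big_ord_recl EFinM /cons_pair tnth0.
  by under eq_bigr do rewrite tnthS.
under eq_integral do rewrite E.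
rewrite ge0_integralZr//.
- by apply/measurable_EFinP; exact: mk.
- by move=> x _; rewrite lee_fin.
- by apply: integral_ge0 => t _; rewrite lee_fin prodr_ge0.
Qed.
End vol_product.

Section gaussian_integrals.
Context {R : realType}.
Local Notation mu := (@lebesgue_measure R).

Definition sqnorm d (x : d.-tuple R) : R := \sum_(i < d) tnth x i ^+ 2.
Definition dotp d (x y : d.-tuple R) : R := \sum_(i < d) tnth x i * tnth y i.

Lemma sqnorm_ge0 d (x : d.-tuple R) : 0 <= sqnorm x.
Proof. by apply: sumr_ge0 => i _; exact: sqr_ge0. Qed.

Lemma measurable_sqnorm d : measurable_fun setT (@sqnorm d).
Proof.
apply: measurable_sum => i; apply: measurable_funX; exact: measurable_tnth.
Qed.

Lemma measurable_dotp d (b : d.-tuple R) : measurable_fun setT (dotp b).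
Proof.
apply: measurable_sum => i; apply: measurable_funM => //; exact: measurable_tnth.
Qed.

Lemma ball2E d (r : R) : 0 <= r -> ball2 d r = [set x | sqnorm x <= r ^+ 2].
Proof.
move=> r0; apply/seteqP; split => x /=; rewrite /ball2/= /norm2 -/(sqnorm x).
  by move=> h; rewrite -(sqr_sqrtr (sqnorm_ge0 x)) ler_sqr// nnegrE sqrtr_ge0.
by move=> h; rewrite -(ler_sqr (sqrtr_ge0 _))// sqr_sqrtr ?sqnorm_ge0.
Qed.

Lemma measurable_ball2 d (r : R) : measurable (ball2 d r).
Proof.
have -> : ball2 d r = setT `&` (fun x => norm2 x) @^-1` `]-oo, r].
  by rewrite setTI; apply/seteqP; split => x /=; rewrite in_itv/=.
have m : measurable_fun setT (@norm2 R d).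
  have ms : measurable_fun setT (@Num.sqrt R).
    by apply: continuous_measurable_fun; exact: sqrt_continuous.
  exact: (measurableT_comp ms (@measurable_sqnorm d)).
exact: m.
Qed.

(** Completing the square: the integrand is a multiple of the normal density with
    mean b / 2a and variance 1 / 2a. *)
Lemma integral_gauss1 (a b : R) : 0 < a ->
  (\int[mu]_x (expR (- a * x ^+ 2 + b * x))%:E =
   (Num.sqrt (pi / a) * expR (b ^+ 2 / (4 * a)))%:E)%E.
Proof.
move=> a0.
pose s := Num.sqrt (2 * a)^-1.
have s2 : s ^+ 2 = (2 * a)^-1 by rewrite sqr_sqrtr// invr_ge0 mulr_ge0// ltW.
have s0 : s != 0 by rewrite gt_eqF// sqrtr_gt0 invr_gt0 mulr_gt0.
have an0 : a != 0 by rewrite gt_eqF.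
have pa0 : Num.sqrt (pi / a) != 0 by rewrite gt_eqF// sqrtr_gt0 divr_gt0// pi_gt0.
have E x : expR (- a * x ^+ 2 + b * x) =
    Num.sqrt (pi / a) * expR (b ^+ 2 / (4 * a)) * normal_pdf (b / (2 * a)) s x.
  rewrite normal_pdfE// /normal_peak /normal_fun s2.
  rewrite (_ : (2 * a)^-1 * pi *+ 2 = pi / a); last by rewrite -mulr_natr; field.
  rewrite mulrAC !mulrA mulfV// mul1r -expRD; congr expR.
  by rewrite -mulr_natr; field.
under eq_integral do rewrite E EFinM.
rewrite ge0_integralZl//; first last.
- by move=> x _; rewrite lee_fin normal_pdf_ge0.
- by apply/measurable_EFinP; exact: measurable_normal_pdf.
by rewrite integral_normal_pdf mule1.
Qed.

Lemma integral_gauss d (a : R) (b : d.-tuple R) : 0 < a ->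
  (\int[vol d]_x (expR (- a * sqnorm x + dotp b x))%:E =
   (Num.sqrt (pi / a) ^+ d * expR (sqnorm b / (4 * a)))%:E)%E.
Proof.
move=> a0.
under eq_integral => x _.
  rewrite (_ : expR _ = \prod_(i < d) expR (- a * tnth x i ^+ 2 + tnth b i * tnth x i)).
    over.
  by rewrite -expR_sum /sqnorm /dotp mulr_sumr -big_split.
rewrite (@integral_vol_prod _ d (fun i t => expR (- a * t ^+ 2 + tnth b i * t))).
- under eq_bigr do rewrite integral_gauss1//.
  rewrite prodEFin; congr EFin.
  rewrite big_split/= prodr_const card_ord -expR_sum.
  by rewrite /sqnorm mulr_suml.
- by move=> i; apply: measurableT_comp => //; apply: measurable_funD => //;
    apply: measurable_funM => //; exact: measurable_funX.
- by move=> i x; exact: expR_ge0.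
Qed.

Lemma dotp0l d (x : d.-tuple R) : dotp [tuple 0 | i < d] x = 0.
Proof. by rewrite /dotp big1// => i _; rewrite tnth_mktuple mul0r. Qed.

Lemma sqnorm0 d : sqnorm [tuple 0 | i < d] = 0.
Proof. by rewrite /sqnorm big1// => i _; rewrite tnth_mktuple expr0n. Qed.

Lemma integral_gauss0 d (a : R) : 0 < a ->
  (\int[vol d]_x (expR (- a * sqnorm x))%:E = (Num.sqrt (pi / a) ^+ d)%:E)%E.
Proof.
move=> a0; have := integral_gauss [tuple 0 | i < d] a0.
rewrite sqnorm0 mul0r expR0 mulr1 => <-.
by apply: eq_integral => x _; rewrite dotp0l addr0.
Qed.
Lemma measurable_gauss_weight d (c : R) :
  measurable_fun setT (fun x : d.-tuple R => expR (c * sqnorm x)).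
Proof.
by apply: measurableT_comp => //; apply: measurable_funM => //; exact: measurable_sqnorm.
Qed.

Lemma integral_gaussZ d (c a : R) : 0 <= c -> 0 < a ->
  (\int[vol d]_x (c * expR (- a * sqnorm x))%:E = (c * Num.sqrt (pi / a) ^+ d)%:E)%E.
Proof.
move=> c0 a0; under eq_integral do rewrite EFinM.
rewrite ge0_integralZl ?lee_fin//; first by rewrite integral_gauss0.
by apply/measurable_EFinP; exact: measurable_gauss_weight.
Qed.
End gaussian_integrals.

(** * Gaussian laws on R^d *)

Section density.
Context {d : measure_display} {T : measurableType d} {R : realType}.
Local Notation leb := (@lebesgue_measure R).
Local Open Scope ereal_scope.

(** The layer-cake formula for nu and Tonelli for the product of mu with the line
    both express the integral of f through the sets where f > t, whose
    nu-measure is by assumption an integral against mu. *)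
Lemma ge0_integral_density (mu nu : {sigma_finite_measure set T -> \bar R})
    (g f : T -> R) :
  measurable_fun setT g -> (forall x, (0 <= g x)%R) ->
  (forall A, measurable A -> nu A = \int[mu]_(x in A) (g x)%:E) ->
  measurable_fun setT f -> (forall x, (0 <= f x)%R) ->
  \int[nu]_x (f x)%:E = \int[mu]_x (f x * g x)%:E.
Proof.
move=> mg g0 nuE mf f0.
pose S : set (T * R) := [set p | (0 < p.2)%R /\ (p.2 < f p.1)%R].
have mS : measurable S.
  rewrite (_ : S = (setT `&` [set p : T * R | (cst 0 p) < (p.2)%:E]) `&`
                 (setT `&` [set p : T * R | (p.2)%:E < (f p.1)%:E])).
    apply: measurableI.
      apply: measurable_lte => //; exact/measurable_EFinP.
    apply: measurable_lte => //; first exact/measurable_EFinP.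
    by apply/measurable_EFinP; exact: measurableT_comp.
  by rewrite !setTI; apply/seteqP; split => -[x t] /= [h1 h2]; split.
pose F (p : T * R) := ((\1_S p) * g p.1)%:E : \bar R.
have mF : measurable_fun setT F.
  apply/measurable_EFinP; apply: measurable_funM; first exact: measurable_indic.
  exact: measurableT_comp.
have F0 p : 0 <= F p by rewrite lee_fin mulr_ge0.
have SE x t : \1_S (x, t) = \1_(xsection S x) t :> R.
  by rewrite !indicE /xsection; congr (_%:R); rewrite !mem_setE.
have SE' x t : \1_S (x, t) = \1_(ysection S t) x :> R.
  by rewrite !indicE /ysection; congr (_%:R); rewrite !mem_setE.
rewrite (ge0_integral_layer_cake nu); first last.
- by move=> x; rewrite lee_fin.
- exact/measurable_EFinP.
transitivity (\int[mu \x leb]_p F p).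
  rewrite fubini_tonelli2//; apply: eq_integral => t _.
  rewrite /superlevel_measure /fubini_G.
  rewrite (_ : [set x | _] = ysection S t); last first.
    by apply/seteqP; split => x; rewrite /ysection/= in_setE/= lte_fin.
  rewrite nuE; last exact: measurable_ysection.
  rewrite [LHS]integral_mkcond epatch_indic; apply: eq_integral => x _.
  by rewrite /F/= SE' -EFinM mulrC.
rewrite fubini_tonelli1//; apply: eq_integral => x _; rewrite /fubini_F.
under eq_integral do rewrite /F/= SE EFinM.
rewrite ge0_integralZr//; first last.
- by rewrite lee_fin.
- by apply/measurable_EFinP; apply: measurable_indic; exact: measurable_xsection.
rewrite integral_indic ?setIT//; last exact: measurable_xsection.
rewrite EFinM; congr (_ * _).
rewrite (_ : xsection S x = `]0%R, f x[%classic); last first.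
  by apply/seteqP; split => t; rewrite /xsection/= in_setE/= in_itv/= /S/=;
    [move=> [-> ->]|move/andP].
rewrite [LHS](lebesgue_measure_itv (Interval (BRight 0%R) (BLeft (f x))))/= lte_fin.
rewrite -EFinB subr0; case: ltP => // fx0.
by congr (_%:E); apply/eqP; rewrite eq_le fx0 f0.
Qed.
End density.

Section gaussian_law.
Context {R : realType}.
Local Notation mu := (@lebesgue_measure R).

(** Boxes form a pi-system, so this makes them sufficient to identify a law on R^d. *)
Lemma tuple_measurable_boxes d : @measurable _ (d.-tuple R) =
  <<s [set B | exists2 A : 'I_d -> set R, (forall i, measurable (A i)) &
        B = [set x : d.-tuple R | forall i, A i (tnth x i)]] >>.
Proof.
apply/seteqP; split; last first.
  apply: smallest_sub; first exact: sigma_algebra_measurable.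
  by move=> _ [A mA ->]; exact: measurable_box.
apply: smallest_sub; first exact: smallest_sigma_algebra.
case: d => [|d]; first by rewrite big_ord0.
rewrite -bigcup_mkord_ord; apply: bigcup_sub => i Ii _ [B mB <-].
apply: sub_sigma_algebra.
exists (fun j => if j == inord i then B else setT).
  by move=> j; case: ifP.
rewrite setTI; apply/seteqP; split => x /=.
  by move=> Bx j; case: eqP => // ->.
by move=> /(_ (inord i)); rewrite eqxx.
Qed.

Definition gaussian_pdf d (th x : d.-tuple R) : R :=
  \prod_(i < d) normal_pdf (tnth th i) 1 (tnth x i).

Lemma gaussian_pdf_ge0 d (th x : d.-tuple R) : 0 <= gaussian_pdf th x.
Proof. by apply: prodr_ge0 => i _; exact: normal_pdf_ge0. Qed.

Lemma measurable_gaussian_pdf d (th : d.-tuple R) :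
  measurable_fun setT (gaussian_pdf th).
Proof.
apply: (@measurable_prod_tnth _ _ (fun i => normal_pdf (tnth th i) 1)) => i.
exact: measurable_normal_pdf.
Qed.

Section gaussian_measure.
Variables (d : nat) (th : d.-tuple R).
Definition gaussian_measure (A : set (d.-tuple R)) : \bar R :=
  (\int[vol d]_(x in A) (gaussian_pdf th x)%:E)%E.

Let gaussian_measure0 : gaussian_measure set0 = 0%E.
Proof. by rewrite /gaussian_measure integral_set0. Qed.

Let gaussian_measure_ge0 A : (0 <= gaussian_measure A)%E.
Proof. by apply: integral_ge0 => x _; rewrite lee_fin gaussian_pdf_ge0. Qed.

Let gaussian_measure_sigma_additive : semi_sigma_additive gaussian_measure.
Proof.
move=> F mF tF mUF; rewrite /gaussian_measure ge0_integral_bigcup//.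
- apply: is_cvg_ereal_nneg_natsum_cond => n _ _.
  exact: gaussian_measure_ge0.
- by apply: measurable_funTS; apply/measurable_EFinP; exact: measurable_gaussian_pdf.
- by move=> x _; rewrite lee_fin gaussian_pdf_ge0.
Qed.

HB.instance Definition _ := isMeasure.Build _ _ _ gaussian_measure
  gaussian_measure0 gaussian_measure_ge0 gaussian_measure_sigma_additive.

End gaussian_measure.

Lemma gaussian_measure_box d (th : d.-tuple R) (A : 'I_d -> set R) :
  (forall i, measurable (A i)) ->
  gaussian_measure th [set x | forall i, A i (tnth x i)] =
  (\prod_(i < d) \int[mu]_(x in A i) (normal_pdf (tnth th i) 1 x)%:E)%E.
Proof.
move=> mA; rewrite /gaussian_measure integral_mkcond epatch_indic.
pose k i x := normal_pdf (tnth th i) 1 x * \1_(A i) x.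
transitivity (\int[vol d]_x (\prod_(i < d) k i (tnth x i))%:E)%E.
  apply: eq_integral => x _; rewrite -EFinM /k big_split/=; congr (_ * _)%:E.
  rewrite indicE; have [h|h] := boolP (x \in _).
    rewrite big1// => i _; rewrite indicE mem_set//.
    by move: h; rewrite in_setE; exact.
  have [i Ai] : exists i, ~ A i (tnth x i).
    by apply/existsNP => h'; move/negP: h; apply; rewrite in_setE.
  by rewrite (bigD1 i)//= indicE memNset// mul0r.
rewrite integral_vol_prod.
- apply: eq_bigr => i _; rewrite [RHS]integral_mkcond epatch_indic.
  by apply: eq_integral => x _; rewrite /k EFinM.
- by move=> i; apply: measurable_funM; [exact: measurable_normal_pdf|exact: measurable_indic].
- by move=> i x; rewrite mulr_ge0 ?normal_pdf_ge0.
Qed.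

Lemma normal_prob_addr (t : R) (A : set R) : measurable A ->
  normal_prob 0 1 ((fun x => x + t) @^-1` A) =
  (\int[mu]_(x in A) (normal_pdf t 1 x)%:E)%E.
Proof.
move=> mA; rewrite /normal_prob [LHS]integral_mkcond [RHS]integral_mkcond !epatch_indic.
rewrite -[RHS](@ge0_integral_addr _ t).
- apply: eq_integral => x _; congr (_ * _)%E.
  + rewrite !normal_pdfE ?oner_neq0//; congr (_ * _)%:E.
    by rewrite /normal_fun addrK subr0.
- apply: emeasurable_funM; apply/measurable_EFinP.
    exact: measurable_normal_pdf.
  exact: measurable_indic.
- by move=> x; rewrite mule_ge0 ?lee_fin ?normal_pdf_ge0.
Qed.

End gaussian_law.

(** * The law of the shifted noise *)

Section noise_law.
Context {R : realType} {dO : measure_display} {Omega : measurableType dO}.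
Variables (P : probability Omega R) (eps : nat -> {RV P >-> R}).
Hypothesis heps : iid_standard_normal eps.

Variables (d : nat) (th : d.-tuple R).

Let shifted w := tuple_add th (noise eps d w).

Let measurable_shifted : measurable_fun setT shifted.
Proof.
apply/measurable_fun_tnthP => i.
rewrite (_ : _ \o _ = fun w => tnth th i + eps i w).
  by apply: measurable_funD => //; exact: measurable_funP.
by apply/funext => w /=; rewrite /shifted !tnth_mktuple.
Qed.

Let X : {RV P >-> d.-tuple R} :=
  HB.pack shifted (isMeasurableFun.Build _ _ _ _ shifted measurable_shifted).

Let box_law (A : 'I_d -> set R) : (forall i, measurable (A i)) ->
  P (shifted @^-1` [set x | forall i, A i (tnth x i)]) =
  gaussian_measure th [set x | forall i, A i (tnth x i)].
Proof.
move=> mA; rewrite gaussian_measure_box//.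
(* Independence speaks of sets indexed by nat; those beyond d are taken to be everything. *)
pose B (n : nat) := if insub n is Some i then (fun x => x + tnth th i) @^-1` (A i) else setT.
have BE (i : 'I_d) : B i = (fun x => x + tnth th i) @^-1` (A i).
  rewrite /B insubT//= => ?; congr (_ @^-1` A _); last exact: val_inj.
  by apply/funext => x; congr (_ + tnth _ _); exact: val_inj.
have mB n : measurable (B n).
  rewrite /B; case: insubP => [i _ _|_]//; exact: measurable_addr_preimage.
pose J : {fset nat} := seq_fset tt (iota 0 d).
have memJ n : (n \in J) = (n < d)%N by rewrite seq_fsetE mem_iota.
have -> : shifted @^-1` [set x | forall i, A i (tnth x i)] =
    \bigcap_(n in [set` J]) (eps n @^-1` B n).
  apply/seteqP; split => w /=.
    move=> h n /=; rewrite memJ => nd; rewrite (BE (Ordinal nd)) /=.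
    by have := h (Ordinal nd); rewrite /shifted !tnth_mktuple addrC.
  move=> h i; have := h i; rewrite /= memJ ltn_ord => /(_ isT).
  by rewrite BE /= /shifted !tnth_mktuple addrC.
have [ind law] := heps.
rewrite (ind J B mB).
rewrite (perm_big (iota 0 d)); last first.
  by apply: uniq_perm; [exact: fset_uniq|exact: iota_uniq|move=> n; rewrite memJ mem_iota].
have -> : iota 0 d = index_iota 0 d by rewrite /index_iota subn0.
rewrite big_mkord; apply: eq_bigr => i _.
have -> : P (eps i @^-1` B i) = distribution P (eps i) (B i) by [].
by rewrite law// BE; exact: normal_prob_addr.
Qed.

(** On boxes, both sides are products of one-dimensional normal probabilities: the
    left one by independence, the right one by Tonelli. *)
Lemma noise_law (A : set (d.-tuple R)) : measurable A ->
  distribution P X A = gaussian_measure th A.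
Proof.
move=> mA.
apply: (measure_unique _ (fun=> setT) (@tuple_measurable_boxes R d)) => //.
- move=> _ _ [A1 mA1 ->] [A2 mA2 ->]; exists (fun i => A1 i `&` A2 i).
    by move=> i; exact: measurableI.
  apply/seteqP; split => x /=; first by move=> [h1 h2] i; split.
  by move=> h; split => i; have [] := h i.
- by move=> _; exists (fun=> setT) => //; apply/seteqP; split.
- exact: bigcup_const.
- by move=> _ [B mB ->]; exact: box_law.
- by move=> _; rewrite (@le_lt_trans _ _ 1%E)// ?ltry// probability_le1.
Qed.

Lemma expectation_noise (f : d.-tuple R -> R) : measurable_fun setT f ->
  (forall x, 0 <= f x) ->
  ('E_P[fun w => f (tuple_add th (noise eps d w))] =
   \int[vol d]_x (f x * gaussian_pdf th x)%:E)%E.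
Proof.
move=> mf f0; rewrite unlock.
rewrite -(ge0_integral_density (nu := distribution P X) (measurable_gaussian_pdf th)) //.
- rewrite ge0_integral_distribution//; first exact/measurable_EFinP.
- exact: gaussian_pdf_ge0.
- by move=> A mA; exact: noise_law.
Qed.

End noise_law.

(** * Cauchy-Schwarz for a change of measure *)

Section change_of_measure.
Context {R : realType}.

(** The bound with l = A / B is the claim; B = 0 forces A = 0 by letting l grow. *)
Lemma sqr_le_mul (A B C : R) : 0 <= A -> 0 <= B -> 0 <= C ->
  (forall l, 0 < l -> 2 * A <= l * B + l^-1 * C) -> A ^+ 2 <= B * C.
Proof.
move=> A0 B0 C0 H.
have [->|An0] := eqVneq A 0; first by rewrite expr0n/= mulr_ge0.
have Ap : 0 < A by rewrite lt_def An0.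
have [B0'|Bn0] := eqVneq B 0.
  have := H ((C + 1) / A); rewrite divr_gt0 ?ltr_wpDl// => /(_ isT).
  rewrite B0' mulr0 add0r invf_div => h.
  have : A / (C + 1) * C <= A.
    by rewrite mulrAC ler_pdivrMr ?ltr_wpDl// ler_pM2l// lerDl.
  by lra.
have Bp : 0 < B by rewrite lt_def Bn0.
have := H (A / B); rewrite divr_gt0// => /(_ isT).
rewrite divfK// invf_div => h.
have {}h : A <= B / A * C by lra.
by rewrite expr2 -ler_pdivlMl// mulrA mulrC (mulrC A^-1) mulrC.
Qed.

(** The Cauchy-Schwarz inequality for g p = sqrt(g q) sqrt(g r), followed by g <= 1 in
    the last factor.  With p and q densities, r = p^2 / q has integral one plus
    the chi-square divergence of p from q: a test with small mean under q has small
    mean under p. *)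
Lemma sqr_integral_le (d : measure_display) (T : measurableType d)
    (mu : {measure set T -> \bar R}) (g p q r : T -> R) (A B C : R) :
  measurable_fun setT g -> measurable_fun setT p -> measurable_fun setT q ->
  measurable_fun setT r ->
  (forall x, 0 <= g x <= 1) -> (forall x, 0 <= p x) -> (forall x, 0 <= q x) ->
  (forall x, 0 <= r x) -> (forall x, p x ^+ 2 = q x * r x) ->
  (\int[mu]_x (g x * p x)%:E = A%:E)%E -> (\int[mu]_x (g x * q x)%:E = B%:E)%E ->
  (\int[mu]_x (r x)%:E = C%:E)%E ->
  A ^+ 2 <= B * C.
Proof.
move=> mg mp mq mr g01 p0 q0 r0 pqr EA EB EC.
have g0 x : 0 <= g x by case/andP: (g01 x).
have gp0 x : 0 <= g x * p x by rewrite mulr_ge0.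
have gq0 x : 0 <= g x * q x by rewrite mulr_ge0.
have mgp : measurable_fun setT (fun x => g x * p x) by exact: measurable_funM.
have mgq : measurable_fun setT (fun x => g x * q x) by exact: measurable_funM.
apply: sqr_le_mul.
- by rewrite -lee_fin -EA; apply: integral_ge0 => x _; rewrite lee_fin.
- by rewrite -lee_fin -EB; apply: integral_ge0 => x _; rewrite lee_fin.
- by rewrite -lee_fin -EC; apply: integral_ge0 => x _; rewrite lee_fin.
move=> l l0; rewrite -lee_fin EFinD !EFinM -EA -EB -EC.
rewrite -!ge0_integralZl//; try (by apply/measurable_EFinP);
  try (by move=> x _; rewrite lee_fin); try by rewrite lee_fin ?invr_ge0 ltW.
rewrite -ge0_integralD//; first last.
- by apply/measurable_EFinP; exact: measurable_funM.
- by move=> x _; rewrite lee_fin mulr_ge0// invr_ge0 ltW.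
- by apply/measurable_EFinP; exact: measurable_funM.
- by move=> x _; rewrite lee_fin mulr_ge0// ltW.
apply: ge0_le_integral => //.
- by move=> x _; rewrite lee_fin mulr_ge0.
- by apply/measurable_EFinP; exact: measurable_funM.
- by apply/measurable_EFinP; apply: measurable_funD; exact: measurable_funM.
move=> x _; rewrite -!EFinM -EFinD lee_fin.
have H : 2 * p x <= l * q x + l^-1 * r x.
  rewrite -ler_sqr ?nnegrE ?addr_ge0 ?mulr_ge0 ?invr_ge0 ?(ltW l0)//.
  rewrite -subr_ge0 exprMn pqr (_ : _ - _ = (l * q x - l^-1 * r x) ^+ 2) ?sqr_ge0//.
  by field; rewrite gt_eqF.
have H1 : g x * (2 * p x) <= g x * (l * q x + l^-1 * r x) by exact: ler_wpM2l.
have H2 : g x * (l^-1 * r x) <= l^-1 * r x.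
  by rewrite ler_piMl// ?mulr_ge0 ?invr_ge0 ?(ltW l0)//; case/andP: (g01 x).
by lra.
Qed.
End change_of_measure.

(** * Gaussian means of a bounded function *)

Section gaussian_means.
Context {R : realType} (d : nat).
Implicit Types x y z th : d.-tuple R.

Let N : R := Num.sqrt (pi / 2^-1) ^+ d.

Let N0 : 0 < N.
Proof. by rewrite exprn_gt0// sqrtr_gt0 divr_gt0// pi_gt0. Qed.

Lemma gaussian_pdfE th y : gaussian_pdf th y =
  N^-1 * expR (- (sqnorm th / 2)) * expR (- 2^-1 * sqnorm y + dotp th y).
Proof.
rewrite -mulrA -expRD /gaussian_pdf.
rewrite (_ : - _ + _ = \sum_(i < d) (- (tnth y i - tnth th i) ^+ 2 / 2)); last first.
  rewrite /sqnorm /dotp mulr_suml mulr_sumr -sumrN -!big_split/=.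
  by apply: eq_bigr => i _; field.
have -> : N^-1 = \prod_(i < d) (Num.sqrt (pi / 2^-1))^-1.
  by rewrite prodr_const card_ord exprVn.
rewrite expR_sum -big_split/=.
apply: eq_bigr => i _; rewrite normal_pdfE ?oner_neq0//.
rewrite /normal_peak /normal_fun expr1n mul1r; congr ((Num.sqrt _)^-1 * expR _).
  by rewrite invrK mulr_natr.
Qed.

Lemma gaussian_pdfC th y : gaussian_pdf th y = gaussian_pdf y th.
Proof.
apply: eq_bigr => i _; rewrite !normal_pdfE ?oner_neq0// /normal_fun.
by rewrite -sqrrN opprB.
Qed.

Lemma integral_gaussian_pdf th : (\int[vol d]_y (gaussian_pdf th y)%:E = 1)%E.
Proof.
under eq_integral do rewrite gaussian_pdfE EFinM.
rewrite ge0_integralZl//; first last.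
- by rewrite lee_fin mulr_ge0 ?expR_ge0// invr_ge0 ltW.
- apply/measurable_EFinP; apply: measurableT_comp => //; apply: measurable_funD.
    by apply: measurable_funM => //; exact: measurable_sqnorm.
  exact: measurable_dotp.
rewrite integral_gauss// -EFinM; congr EFin; rewrite -/N.
rewrite mulrCA !mulrA divff ?gt_eqF// mul1r -expRD.
by rewrite (_ : _ + _ = 0) ?expR0//; field.
Qed.

Definition sqdist x y : R := \sum_(i < d) (tnth x i - tnth y i) ^+ 2.

Variable g : d.-tuple R -> R.
Hypotheses (mg : measurable_fun setT g) (g01 : forall y, 0 <= g y <= 1).

(** For g = 1 - psi, this is the error of the second kind at th of the test psi. *)
Definition gaussian_mean th : R := fine (\int[vol d]_y (g y * gaussian_pdf th y)%:E)%E.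

Let g0 y : 0 <= g y. Proof. by case/andP: (g01 y). Qed.

Let gp0 th y : 0 <= g y * gaussian_pdf th y.
Proof. by rewrite mulr_ge0// gaussian_pdf_ge0. Qed.

Let integral_le1 th : (\int[vol d]_y (g y * gaussian_pdf th y)%:E <= 1)%E.
Proof.
rewrite -(integral_gaussian_pdf th); apply: ge0_le_integral => //.
- by move=> y _; rewrite lee_fin.
- apply/measurable_EFinP; apply: measurable_funM => //; exact: measurable_gaussian_pdf.
- apply/measurable_EFinP; exact: measurable_gaussian_pdf.
- by move=> y _; rewrite lee_fin ler_piMl ?gaussian_pdf_ge0//; case/andP: (g01 y).
Qed.

Let integral_fin th : (\int[vol d]_y (g y * gaussian_pdf th y)%:E)%E \is a fin_num.
Proof.
rewrite ge0_fin_numE ?(le_lt_trans (integral_le1 _)) ?ltry//.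
by apply: integral_ge0 => y _; rewrite lee_fin.
Qed.

Lemma gaussian_meanE th : ((gaussian_mean th)%:E = \int[vol d]_y (g y * gaussian_pdf th y)%:E)%E.
Proof. by rewrite /gaussian_mean fineK. Qed.

Lemma gaussian_mean_ge0 th : 0 <= gaussian_mean th.
Proof. by apply/fine_ge0/integral_ge0 => y _; rewrite lee_fin. Qed.

Lemma gaussian_mean_le1 th : gaussian_mean th <= 1.
Proof. by rewrite -lee_fin gaussian_meanE. Qed.

Let measurable_joint : measurable_fun setT
  (fun p : d.-tuple R * d.-tuple R => (g p.2 * gaussian_pdf p.1 p.2)%:E).
Proof.
apply/measurable_EFinP; apply: measurable_funM; first exact: measurableT_comp.
apply: measurable_prod => i _ _.
have -> : (fun p : d.-tuple R * d.-tuple R => normal_pdf (tnth p.1 i) 1 (tnth p.2 i)) =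
    (fun p => normal_pdf 0 1 (tnth p.2 i - tnth p.1 i)).
  by apply/funext => p; rewrite !normal_pdfE ?oner_neq0// /normal_fun subr0.
apply: measurableT_comp => //; first exact: measurable_normal_pdf.
apply: measurable_funB.
  exact: (measurableT_comp (@measurable_tnth _ _ _ i) measurable_snd).
exact: (measurableT_comp (@measurable_tnth _ _ _ i) measurable_fst).
Qed.

Let joint_ge0 (p : d.-tuple R * d.-tuple R) : (0 <= (g p.2 * gaussian_pdf p.1 p.2)%:E)%E.
Proof. by rewrite lee_fin. Qed.

Lemma measurable_gaussian_mean : measurable_fun setT gaussian_mean.
Proof.
apply: measurableT_comp => //.
exact: (measurable_fun_fubini_tonelli_F (m2 := vol d) _ measurable_joint joint_ge0).
Qed.

Let measurable_exp (c : R) (b : d.-tuple R) :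
  measurable_fun setT (fun x => expR (c * sqnorm x + dotp b x)).
Proof.
apply: measurableT_comp => //; apply: measurable_funD.
  by apply: measurable_funM => //; exact: measurable_sqnorm.
exact: measurable_dotp.
Qed.

(** Change of measure from the law centred at y to that centred at x, for which the
    second moment of the density ratio is exp |x - y|^2.  This plays the role of a
    Lipschitz estimate. *)
Lemma gaussian_mean_harnack x y : gaussian_mean x ^+ 2 <= gaussian_mean y * expR (sqdist x y).
Proof.
pose b := [tuple 2 * tnth x i - tnth y i | i < d].
pose k := N^-1 * expR (- sqnorm x + sqnorm y / 2).
apply: (@sqr_integral_le R _ _ (vol d) g (gaussian_pdf x) (gaussian_pdf y)
  (fun z => k * expR (- 2^-1 * sqnorm z + dotp b z))) => //.
- exact: measurable_gaussian_pdf.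
- exact: measurable_gaussian_pdf.
- exact: measurable_funM.
- exact: gaussian_pdf_ge0.
- exact: gaussian_pdf_ge0.
- by move=> z; rewrite !mulr_ge0 ?expR_ge0// invr_ge0 ltW.
- move=> z; rewrite !gaussian_pdfE /k.
  rewrite -!(mulrA N^-1) -!expRD exprMn [RHS]mulrA [RHS]mulrACA -expRD !expr2 -expRD.
  congr (_ * expR _).
  rewrite /sqnorm /dotp !mulr_suml !mulr_sumr -!sumrN -!big_split/=.
  by apply: eq_bigr => i _; rewrite tnth_mktuple; field.
- by rewrite gaussian_meanE.
- by rewrite gaussian_meanE.
under eq_integral do rewrite EFinM.
rewrite ge0_integralZl//; first last.
- by rewrite lee_fin mulr_ge0 ?expR_ge0// invr_ge0 ltW.
- exact/measurable_EFinP.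
rewrite integral_gauss// -EFinM; congr EFin.
rewrite -/N /k mulrCA !mulrA divff ?gt_eqF// mul1r -expRD.
congr expR; rewrite /sqnorm /sqdist !mulr_suml -sumrN -!big_split/=.
by apply: eq_bigr => i _; rewrite tnth_mktuple; field.
Qed.


(** The Gaussian mixture of the laws centred at th, with th of covariance 1/(2a), has
    covariance 1 + 1/(2a).  The density of the standard normal law with respect to it
    has as second moment, in each coordinate, the square root of
    1 + 1/(4a(a+1)) <= exp(1/(4a^2)), whence the exponent d/(8a^2). *)
Lemma gaussian_mean0_le (a I : R) : 0 < a ->
  (\int[vol d]_th (expR (- a * sqnorm th) * gaussian_mean th)%:E = I%:E)%E ->
  gaussian_mean [tuple 0 | i < d] ^+ 2 * Num.sqrt (pi / a) ^+ d <=
    I * expR (d%:R / (8 * a ^+ 2)).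
Proof.
move=> a0 IE.
have ah0 : 0 < a + 2^-1 by rewrite addr_gt0.
pose K : R := Num.sqrt (pi / (a + 2^-1)) ^+ d.
have K0 : 0 < K by rewrite exprn_gt0// sqrtr_gt0 divr_gt0// pi_gt0.
pose c := 2^-1 - (4 * (a + 2^-1))^-1.
pose c' := 2^-1 + (4 * (a + 2^-1))^-1.
have c'0 : 0 < c' by rewrite addr_gt0// invr_gt0 mulr_gt0.
pose q (y : d.-tuple R) := N^-1 * K * expR (- c * sqnorm y).
pose r (y : d.-tuple R) := N^-1 * K^-1 * expR (- c' * sqnorm y).
have q0 y : 0 <= q y by rewrite !mulr_ge0 ?expR_ge0 ?invr_ge0// ltW.
have r0 y : 0 <= r y by rewrite !mulr_ge0 ?expR_ge0 ?invr_ge0// ltW.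
(* The unnormalised density of the mixture is q, and r is the ratio p^2 / q for p the
   standard normal density. *)
have mixture y :
    (\int[vol d]_th (expR (- a * sqnorm th) * gaussian_pdf th y)%:E = (q y)%:E)%E.
  have E th : expR (- a * sqnorm th) * gaussian_pdf th y =
      N^-1 * expR (- 2^-1 * sqnorm y) * expR (- (a + 2^-1) * sqnorm th + dotp y th).
    rewrite gaussian_pdfE mulrC -!mulrA -!expRD; congr (_ * expR _).
    rewrite /sqnorm /dotp !mulr_suml !mulr_sumr -!sumrN -!big_split/=.
    by apply: eq_bigr => i _; field.
  under eq_integral do rewrite E EFinM.
  rewrite ge0_integralZl//; first last.
  - by rewrite lee_fin mulr_ge0 ?expR_ge0// invr_ge0 ltW.
  - exact/measurable_EFinP.
  rewrite integral_gauss// -EFinM -/K /q; congr EFin.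
  rewrite mulrACA -expRD; congr (_ * expR _).
  by rewrite /c; field; rewrite gt_eqF//; lra.
have Iq : (\int[vol d]_y (g y * q y)%:E = I%:E)%E.
  pose F (p : d.-tuple R * d.-tuple R) :=
    (expR (- a * sqnorm p.1) * (g p.2 * gaussian_pdf p.1 p.2))%:E.
  have mF : measurable_fun setT F.
    apply/measurable_EFinP; apply: measurable_funM; last exact/measurable_EFinP.
    exact: (measurableT_comp (@measurable_gauss_weight R d (- a)) measurable_fst).
  have F0 p : (0 <= F p)%E by rewrite lee_fin mulr_ge0 ?expR_ge0.
  rewrite -IE; transitivity (\int[vol d \x vol d]_p F p)%E; last first.
    rewrite fubini_tonelli1//; apply: eq_integral => th _; rewrite /fubini_F /F/=.
    under eq_integral do rewrite EFinM.
    rewrite ge0_integralZl ?lee_fin ?expR_ge0//.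
    - by rewrite EFinM gaussian_meanE.
    - apply/measurable_EFinP; apply: measurable_funM => //; exact: measurable_gaussian_pdf.
    - by move=> y _; rewrite lee_fin.
  rewrite fubini_tonelli2//; apply: eq_integral => y _; rewrite /fubini_G /F/=.
  under eq_integral do rewrite mulrCA EFinM.
  rewrite ge0_integralZl ?lee_fin//.
  - by rewrite mixture -EFinM.
  - apply/measurable_EFinP; apply: measurable_funM; first exact: measurable_gauss_weight.
    have -> : (fun th : d.-tuple R => gaussian_pdf th y) = @gaussian_pdf R d y.
      by apply/funext => th; exact: gaussian_pdfC.
    exact: measurable_gaussian_pdf.
  - by move=> th _; rewrite lee_fin mulr_ge0 ?expR_ge0 ?gaussian_pdf_ge0.
have Ir : (\int[vol d]_y (r y)%:E =
    (N^-1 * K^-1 * Num.sqrt (pi / c') ^+ d)%:E)%E.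
  under eq_integral do rewrite EFinM.
  rewrite ge0_integralZl ?lee_fin ?mulr_ge0 ?invr_ge0 ?ltW//.
    by rewrite integral_gauss0.
  by apply/measurable_EFinP; exact: measurable_gauss_weight.
have H := @sqr_integral_le R _ _ (vol d) g (gaussian_pdf [tuple 0 | i < d]) q r _ _ _
  mg (measurable_gaussian_pdf _) _ _ g01 (gaussian_pdf_ge0 _) q0 r0 _
  (esym (gaussian_meanE _)) Iq Ir.
have {}H : gaussian_mean [tuple 0 | i < d] ^+ 2 <= I * (N^-1 * K^-1 * Num.sqrt (pi / c') ^+ d).
  apply: H.
  - by apply: measurable_funM => //; exact: measurable_gauss_weight.
  - by apply: measurable_funM => //; exact: measurable_gauss_weight.
  move=> y; rewrite gaussian_pdfE sqnorm0 dotp0l /q /r mul0r oppr0 expR0 mulr1 addr0.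
  rewrite exprMn expr2 -expRM_natl.
  rewrite mulrACA -expRD [in RHS]mulrACA divff ?gt_eqF// mulr1; congr (_ * expR _).
  by rewrite /c /c'; ring.
have I0 : 0 <= I.
  rewrite -lee_fin -Iq; apply: integral_ge0 => y _.
  by rewrite lee_fin mulr_ge0.
apply: (le_trans (ler_wpM2r _ H)).
  by rewrite exprn_ge0.
rewrite -[leLHS]mulrA ler_wpM2l//.
rewrite /N /K -!exprVn -!exprMn expRM_natl.
rewrite lerXn2r ?nnegrE ?expR_ge0 ?mulr_ge0 ?invr_ge0//.
rewrite -ler_sqr ?nnegrE ?expR_ge0 ?mulr_ge0 ?invr_ge0// !exprMn !exprVn.
have pi0 : 0 < pi :> R by exact: pi_gt0.
rewrite !sqr_sqrtr ?divr_ge0 ?(ltW pi0) ?(ltW ah0) ?(ltW c'0) ?(ltW a0)//.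
rewrite -expRM_natl; apply: le_trans (expR_ge1Dx _).
rewrite -subr_ge0 (_ : _ - _ = (4 * a ^+ 2 * (a + 1))^-1).
  by rewrite invr_ge0 !mulr_ge0 ?sqr_ge0 ?addr_ge0 ?(ltW a0).
rewrite /c'; field.
rewrite !gt_eqF//; lra.
Qed.

End gaussian_means.

(** * A lower bound for the volume of the ball *)

Section ball_volume.
Context {R : realType}.

Lemma inv_1Bx_le (x : R) : -2^-1 <= x <= 2^-1 -> (1 - x)^-1 <= expR (x + 2 * x ^+ 2).
Proof.
move=> /andP[x1 x2]; have x0 : 0 < 1 - x by lra.
apply: le_trans (expR_ge1Dx _).
rewrite -[leLHS]mul1r ler_pdivrMr// -subr_ge0.
rewrite (_ : _ - _ = x ^+ 2 * (1 - 2 * x)); last by ring.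
by rewrite mulr_ge0 ?sqr_ge0//; lra.
Qed.

Lemma expR_cosh_ge (s : R) : 2 <= expR s + expR (- s).
Proof. by have := expR_ge1Dx s; have := expR_ge1Dx (- s); lra. Qed.

Lemma expR2_ge4 (s : R) : 2 <= s -> 4 <= expR s.
Proof.
move=> s2; apply: (@le_trans _ _ (expR (1 + 1))).
  by rewrite expRD; have := expR_ge1Dx (1 : R); nra.
by rewrite ler_expR; lra.
Qed.

Lemma expR_quarter : expR (4^-1) <= 4 / 3 :> R.
Proof.
have := expR_ge1Dx (- 4^-1 : R); rewrite expRN => h.
have := ler_wpM2r (expR_ge0 4^-1) h.
by rewrite mulVf ?gt_eqF ?expR_gt0//; lra.
Qed.

(** Under the weight exp(-a|x|^2), |x|^2 concentrates at t0 = d/(2a) with fluctuations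
    sqrt(d)/a, so that most of the mass Z lies in the shell where |x|^2 is within
    4 sqrt(d)/a of t0.  This shell is inside the ball, and on it the weight is at
    most exp(4 sqrt d - d/2).  The mass outside of the shell is controlled by
    exponential moments, that is, by Gaussian integrals of parameters a - b and
    a + b with b = a / (2 sqrt d). *)
Lemma ball_volume_ge d (a r : R) : (0 < d)%N -> 0 < a -> 0 <= r ->
  d%:R / 2 + 4 * Num.sqrt d%:R <= a * r ^+ 2 ->
  ((Num.sqrt (pi / a) ^+ d * (2 / 3 * expR (d%:R / 2 - 4 * Num.sqrt d%:R)))%:E
     <= vol d (ball2 d r))%E.
Proof.
move=> d0 a0 r0 har.
set sd := Num.sqrt d%:R in har *.
have d1 : 1 <= d%:R :> R by rewrite (ler_nat _ 1).
have sd2 : sd ^+ 2 = d%:R by rewrite sqr_sqrtr// ler0n.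
have sd1 : 1 <= sd by rewrite -(sqrtr1 R) ler_sqrt// ltr0n.
have sd0 : 0 < sd by lra.
pose x := (2 * sd)^-1; pose b := a * x.
have x0 : 0 < x by rewrite invr_gt0; lra.
have x12 : x <= 2^-1 by rewrite lef_pV2 ?posrE//; lra.
have xsd : x * sd = 2^-1 by rewrite /x; field; rewrite gt_eqF.
pose Z := Num.sqrt (pi / a) ^+ d.
have pi0 : 0 < pi :> R by exact: pi_gt0.
have Z0 : 0 < Z by rewrite exprn_gt0// sqrtr_gt0 divr_gt0.
pose k := expR (4 * sd - d%:R / 2).
have k0 : 0 < k by exact: expR_gt0.
have B_meas := @measurable_ball2 R d r.
(* With s = b(t - t0), the last two terms add up to exp(-at) cosh s.  This
   is at least 2 exp(-at) when |s| >= 2, and at least exp(-at) otherwise, in which case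
   the point is in the ball and k bounds the other half. *)
have bump (y : d.-tuple R) : 2 * expR (- a * sqnorm y) <= k * \1_(ball2 d r) y +
    (2^-1 * expR (- (sd / 4)) * expR (- (a - b) * sqnorm y) +
     2^-1 * expR (sd / 4) * expR (- (a + b) * sqnorm y)).
  set t := sqnorm y.
  pose s := x * (a * t - d%:R / 2).
  have xd : x * d%:R / 2 = sd / 4.
    by rewrite -sd2 expr2 !mulrA xsd; field.
  have -> : 2^-1 * expR (- (sd / 4)) * expR (- (a - b) * t) =
      2^-1 * (expR (- a * t) * expR s).
    by rewrite -mulrA -!expRD -xd /s /b; congr (_ * expR _); ring.
  have -> : 2^-1 * expR (sd / 4) * expR (- (a + b) * t) =
      2^-1 * (expR (- a * t) * expR (- s)).
    by rewrite -mulrA -!expRD -xd /s /b; congr (_ * expR _); ring.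
  have e0 : 0 < expR (- a * t) by exact: expR_gt0.
  have s0 := expR_gt0 s; have s0' := expR_gt0 (- s).
  have kB0 : 0 <= k * \1_(ball2 d r) y by rewrite mulr_ge0 ?(ltW k0).
  have [s2|s2] := leP 2 s.
    have := expR2_ge4 s2 => s4.
    have : expR (- a * t) * 4 <= expR (- a * t) * expR s by rewrite ler_pM2l.
    have : 0 <= expR (- a * t) * expR (- s) by rewrite mulr_ge0// ltW.
    by move: kB0; lra.
  have [s3|s3] := leP s (- 2).
    have s4 : 4 <= expR (- s) by apply: expR2_ge4; lra.
    have : expR (- a * t) * 4 <= expR (- a * t) * expR (- s) by rewrite ler_pM2l.
    have : 0 <= expR (- a * t) * expR s by rewrite mulr_ge0// ltW.
    by move: kB0; lra.
  have : expR (- a * t) * 2 <= expR (- a * t) * (expR s + expR (- s)).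
    by rewrite ler_pM2l// expR_cosh_ge.
  have h4 : x * (4 * sd) = 2 by rewrite mulrCA xsd; field.
  have yB : ball2 d r y.
    rewrite ball2E//= -/t -(ler_pM2l a0); apply: le_trans har.
    suff : x * (a * t - d%:R / 2) <= x * (4 * sd) by rewrite ler_pM2l//; lra.
    by rewrite h4 -/s ltW.
  rewrite indicE mem_set// mulr1.
  have : expR (- a * t) <= k.
    rewrite ler_expR mulNr.
    suff : x * (- (a * t - d%:R / 2)) <= x * (4 * sd) by rewrite ler_pM2l//; lra.
    by rewrite h4 mulrN -/s; lra.
  by rewrite mulrDr; lra.
have ab0 : 0 < a - b by rewrite subr_gt0 /b gtr_pMr//; lra.
have ab0' : 0 < a + b by rewrite addr_gt0// mulr_gt0.
have I : ((2 * Z)%:E <= k%:E * vol d (ball2 d r) +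
   ((2^-1 * expR (- (sd / 4)) * Num.sqrt (pi / (a - b)) ^+ d +
     2^-1 * expR (sd / 4) * Num.sqrt (pi / (a + b)) ^+ d)%:E))%E.
  pose f1 (y : d.-tuple R) := k * \1_(ball2 d r) y.
  pose f2 (y : d.-tuple R) := 2^-1 * expR (- (sd / 4)) * expR (- (a - b) * sqnorm y).
  pose f3 (y : d.-tuple R) := 2^-1 * expR (sd / 4) * expR (- (a + b) * sqnorm y).
  have f10 y : 0 <= f1 y by rewrite mulr_ge0// ltW.
  have f20 y : 0 <= f2 y by rewrite !mulr_ge0 ?expR_ge0.
  have f30 y : 0 <= f3 y by rewrite !mulr_ge0 ?expR_ge0.
  have mf1 : measurable_fun setT f1 by apply: measurable_funM.
  have mf2 : measurable_fun setT f2.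
    by apply: measurable_funM => //; exact: measurable_gauss_weight.
  have mf3 : measurable_fun setT f3.
    by apply: measurable_funM => //; exact: measurable_gauss_weight.
  have -> : ((2 * Z)%:E = \int[vol d]_y (2 * expR (- a * sqnorm y))%:E)%E.
    by rewrite integral_gaussZ.
  apply: (@le_trans _ _ (\int[vol d]_y ((f1 y)%:E + ((f2 y)%:E + (f3 y)%:E)))%E).
    apply: ge0_le_integral => //.
    - apply/measurable_EFinP; apply: measurable_funM => //; exact: measurable_gauss_weight.
    - apply: emeasurable_funD; first exact/measurable_EFinP.
      apply: emeasurable_funD; exact/measurable_EFinP.
    - by move=> y _; rewrite -!EFinD lee_fin; exact: bump.
  have mF1 : measurable_fun setT (fun y => (f1 y)%:E) by exact/measurable_EFinP.
  have mF2 : measurable_fun setT (fun y => (f2 y)%:E) by exact/measurable_EFinP.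
  have mF3 : measurable_fun setT (fun y => (f3 y)%:E) by exact/measurable_EFinP.
  have mF23 : measurable_fun setT (fun y => (f2 y)%:E + (f3 y)%:E)%E.
    exact: emeasurable_funD.
  have F230 y : (0 <= (f2 y)%:E + (f3 y)%:E)%E by rewrite -EFinD lee_fin addr_ge0.
  have F10 y : (0 <= (f1 y)%:E)%E by rewrite lee_fin.
  have F20 y : (0 <= (f2 y)%:E)%E by rewrite lee_fin.
  have F30 y : (0 <= (f3 y)%:E)%E by rewrite lee_fin.
  rewrite ge0_integralD// ge0_integralD//.
  rewrite EFinD; apply: leeD; last apply: leeD.
  - rewrite /f1; under eq_integral do rewrite EFinM.
    rewrite ge0_integralZl//; first by rewrite integral_indic ?setIT.
      by apply/measurable_EFinP; exact: measurable_indic.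
    by rewrite lee_fin ltW.
  - by rewrite /f2 integral_gaussZ ?mulr_ge0 ?expR_ge0.
  - by rewrite /f3 integral_gaussZ ?mulr_ge0 ?expR_ge0.
(* The choice of b makes each of the two Gaussian integrals, multiplied by its factor
   exp(-+ sd/4), at most Z exp(d x^2) = Z exp(1/4); their mean stays well below 2 Z. *)
have sqrt_le (c : R) : -2^-1 <= c <= 2^-1 ->
    Num.sqrt (pi / (a - a * c)) ^+ d <= Z * expR (d%:R * ((c + 2 * c ^+ 2) / 2)).
  move=> c12.
  have c1 : 0 < 1 - c by move/andP: c12 => []; lra.
  rewrite expRM_natl -exprMn lerXn2r ?nnegrE ?mulr_ge0 ?expR_ge0//.
  rewrite -ler_sqr ?nnegrE ?mulr_ge0 ?expR_ge0// exprMn !sqr_sqrtr.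
  - rewrite -expRM_natl (_ : 2%:R * _ = c + 2 * c ^+ 2); last by field.
    rewrite (_ : pi / (a - a * c) = pi / a * (1 - c)^-1); last first.
      by field; rewrite !gt_eqF// -[X in _ - X]mulrC; nra.
    by rewrite ler_wpM2l ?divr_ge0 ?(ltW pi0) ?(ltW a0)// inv_1Bx_le.
  - by rewrite divr_ge0 ?(ltW pi0) ?(ltW a0).
  - by rewrite divr_ge0 ?(ltW pi0)// -{1}(mulr1 a) -mulrBr mulr_ge0 ?ltW.
have dx2 : d%:R * x ^+ 2 = 4^-1.
  by rewrite -sd2 -exprMn mulrC xsd; field.
have dx : d%:R * x = sd / 2 by rewrite -sd2 expr2 -mulrA (mulrC sd x) xsd.
have T1 : expR (- (sd / 4)) * Num.sqrt (pi / (a - b)) ^+ d <= Z * expR 4^-1.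
  have c1 : - 2^-1 <= x <= 2^-1 by rewrite x12 andbT; lra.
  have := ler_wpM2l (expR_ge0 (- (sd / 4))) (sqrt_le _ c1); rewrite -/b => H.
  apply: (le_trans H); rewrite mulrCA -expRD ler_pM2l// ler_expR.
  by move: dx dx2; lra.
have T2 : expR (sd / 4) * Num.sqrt (pi / (a + b)) ^+ d <= Z * expR 4^-1.
  have c1 : - 2^-1 <= - x <= 2^-1 by apply/andP; split; lra.
  have := ler_wpM2l (expR_ge0 (sd / 4)) (sqrt_le _ c1).
  rewrite mulrN opprK -/b sqrrN => H.
  apply: (le_trans H); rewrite mulrCA -expRD ler_pM2l// ler_expR.
  by move: dx dx2; lra.
have {T1 T2}I' : ((2 / 3 * Z)%:E <= k%:E * vol d (ball2 d r))%E.
  move: I; case: (k%:E * vol d (ball2 d r))%E => [w| |]; last 2 first.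
  - by move=> _; rewrite leey.
  - by rewrite addNye leeNy_eq.
  rewrite -EFinD !lee_fin => I.
  have : Z * expR 4^-1 <= Z * (4 / 3) by rewrite ler_pM2l// expR_quarter.
  by move: T1 T2 I; rewrite -!mulrA; lra.
have -> : expR (d%:R / 2 - 4 * sd) = k^-1 by rewrite -expRN opprB.
rewrite [X in (X%:E <= _)%E](_ : _ = k^-1 * (2 / 3 * Z)); last by rewrite -/Z; ring.
by rewrite EFinM lee_pdivrMl.
Qed.

End ball_volume.

(** * Concentration: the volume of a set of small Gaussian mean *)

Section concentration.
Context {R : realType}.

(** The convex function s^(k+1) lies above its tangent at b. *)
Lemma power_tangent (b s : R) (k : nat) : 0 <= b -> 0 <= s ->
  k.+1%:R * b ^+ k * s <= s ^+ k.+1 + k%:R * b ^+ k.+1.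
Proof.
move=> b0 s0; elim: k => [|k IH]; first by rewrite expr0 !mul1r mul0r addr0 expr1.
have := ler_wpM2l s0 IH.
rewrite -subr_ge0 => H; rewrite -subr_ge0.
have E : s ^+ k.+2 + k.+1%:R * b ^+ k.+2 - k.+2%:R * b ^+ k.+1 * s =
  s * (s ^+ k.+1 + k%:R * b ^+ k.+1) - s * (k.+1%:R * b ^+ k * s) +
  k.+1%:R * b ^+ k * (s - b) ^+ 2.
  by rewrite -![_.+1%:R]natr1 !exprS; ring.
by rewrite E; apply: addr_ge0 => //; rewrite mulr_ge0 ?sqr_ge0 ?mulr_ge0 ?exprn_ge0.
Qed.

Variables (d : nat) (g : d.-tuple R -> R).
Hypotheses (mg : measurable_fun setT g) (g01 : forall y, 0 <= g y <= 1).

Let s0 x : 0 <= gaussian_mean g x := gaussian_mean_ge0 g01 x.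
Let ms := measurable_gaussian_mean mg g01.

(** Jensen's inequality for the power k + 1 and the probability w / Z, obtained by
    integrating the tangent at the mean b. *)
Lemma integral_gauss_power (a b : R) (k : nat) : 0 < a -> 0 <= b ->
  (\int[vol d]_x (expR (- a * sqnorm x) * gaussian_mean g x)%:E =
     (b * Num.sqrt (pi / a) ^+ d)%:E)%E ->
  ((b ^+ k.+1 * Num.sqrt (pi / a) ^+ d)%:E <=
     \int[vol d]_x (expR (- a * sqnorm x) * gaussian_mean g x ^+ k.+1)%:E)%E.
Proof.
move=> a0 b0 Ib; set Z := Num.sqrt (pi / a) ^+ d in Ib *.
pose w (x : d.-tuple R) := expR (- a * sqnorm x).
have w0 x : 0 <= w x by exact: expR_ge0.
have mw : measurable_fun setT w by exact: measurable_gauss_weight.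
have mwk : measurable_fun setT (fun x => w x * gaussian_mean g x ^+ k.+1).
  by apply: measurable_funM => //; exact: measurable_funX.
have {}Ib : (\int[vol d]_x (w x * gaussian_mean g x)%:E = (b * Z)%:E)%E := Ib.
have Ig : (\int[vol d]_x (k%:R * b ^+ k.+1 * w x)%:E = (k%:R * b ^+ k.+1 * Z)%:E)%E.
  by apply: integral_gaussZ; rewrite // mulr_ge0 ?exprn_ge0.
have H : ((k.+1%:R * b ^+ k)%:E * (b * Z)%:E <=
  \int[vol d]_x (w x * gaussian_mean g x ^+ k.+1)%:E + (k%:R * b ^+ k.+1 * Z)%:E)%E.
  have F0 x : (0 <= (w x * gaussian_mean g x)%:E)%E by rewrite lee_fin mulr_ge0.
  have mF0 : measurable_fun setT (fun x => (w x * gaussian_mean g x)%:E).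
    by apply/measurable_EFinP; exact: measurable_funM.
  have c0 : (0 <= (k.+1%:R * b ^+ k)%:E)%E by rewrite lee_fin mulr_ge0 ?exprn_ge0.
  rewrite -Ib -ge0_integralZl//.
  rewrite -Ig.
  have F1 x : (0 <= (w x * gaussian_mean g x ^+ k.+1)%:E)%E.
    by rewrite lee_fin mulr_ge0 ?exprn_ge0.
  have F2 x : (0 <= (k%:R * b ^+ k.+1 * w x)%:E)%E.
    by rewrite lee_fin !mulr_ge0 ?exprn_ge0.
  have mF2 : measurable_fun setT (fun x => (k%:R * b ^+ k.+1 * w x)%:E).
    by apply/measurable_EFinP; exact: measurable_funM.
  have mF1 : measurable_fun setT (fun x => (w x * gaussian_mean g x ^+ k.+1)%:E).
    exact/measurable_EFinP.
  rewrite -ge0_integralD//.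
  apply: ge0_le_integral => //.
  - by move=> x _; rewrite -EFinM lee_fin !mulr_ge0 ?exprn_ge0.
  - exact: measurable_funeM.
  - by apply: emeasurable_funD.
  move=> x _; rewrite -EFinM -EFinD lee_fin -/(w x) [X in _ <= _ + X]mulrC -mulrDr mulrCA.
  by rewrite ler_wpM2l// power_tangent.
move: H; case: (\int[vol d]_x (w x * gaussian_mean g x ^+ k.+1)%:E)%E => [I| |].
- rewrite -EFinM -EFinD !lee_fin => H.
  move: H; rewrite -natr1 !exprS; lra.
- by move=> _; rewrite leey.
- by rewrite addNye leeNy_eq.
Qed.

(** Prekopa-Leindler for u = w G^(2m), v = w 1_D and h a multiple of
    exp(-m|z|^2/2), where w = exp(-2m|x|^2).  The parallelogram identity gives
    w(x) w(y) exp(m|x - y|^2) = exp(-m|x + y|^2), so the pointwise hypothesis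
    is exactly the m-th power of the Harnack inequality combined with G <= dl on D.
    The integral of u is bounded below by Jensen's inequality and that of v by
    exp(-2m r^2) vol(D). *)
Lemma volume_gaussian_mean_small (m : nat) (b r dl : R) (D : set (d.-tuple R)) :
  (0 < m)%N -> 0 <= b -> 0 <= r -> 0 < dl ->
  (\int[vol d]_x (expR (- (2 * m%:R) * sqnorm x) * gaussian_mean g x)%:E =
     (b * Num.sqrt (pi / (2 * m%:R)) ^+ d)%:E)%E ->
  measurable D -> D `<=` ball2 d r -> (forall x, D x -> gaussian_mean g x <= dl) ->
  ((b ^+ (2 * m))%:E * vol d D <=
   (dl ^+ m * expR (2 * m%:R * r ^+ 2) * Num.sqrt (pi / (2 * m%:R)) ^+ d)%:E)%E.
Proof.
move=> m0 b0 r0 dl0 Ib mD Dr Ddl.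
set a : R := 2 * m%:R in Ib *.
have mR0 : 0 < m%:R :> R by rewrite ltr0n.
have a0 : 0 < a by rewrite mulr_gt0.
set Z := Num.sqrt (pi / a) ^+ d in Ib *.
have pi0 : 0 < pi :> R by exact: pi_gt0.
have Z0 : 0 < Z by rewrite exprn_gt0// sqrtr_gt0 divr_gt0.
pose w (x : d.-tuple R) := expR (- a * sqnorm x).
have w0 x : 0 <= w x by exact: expR_ge0.
have mw : measurable_fun setT w by exact: measurable_gauss_weight.
pose u x := w x * gaussian_mean g x ^+ (2 * m).
pose v x := w x * \1_D x.
pose h (x : d.-tuple R) := Num.sqrt dl ^+ m * expR (- (m%:R / 2) * sqnorm x).
have mu_ : measurable_fun setT u by apply: measurable_funM => //; exact: measurable_funX.
have mv : measurable_fun setT v by exact: measurable_funM.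
have mh : measurable_fun setT h.
  by apply: measurable_funM => //; exact: measurable_gauss_weight.
have u0 x : 0 <= u x by rewrite mulr_ge0 ?exprn_ge0.
have v0 x : 0 <= v x by rewrite mulr_ge0.
have h0 x : 0 <= h x by rewrite mulr_ge0 ?expR_ge0 ?exprn_ge0.
have uvh x y : u x * v y <= h (tuple_add x y) * h (tuple_add x y).
  rewrite /v indicE; have [yD|yD] := boolP (y \in D); last by rewrite !mulr0 mulr_ge0.
  (* The parallelogram identity, coordinate by coordinate. *)
  have hE : h (tuple_add x y) * h (tuple_add x y) =
      dl ^+ m * (w x * w y * expR (m%:R * sqdist x y)).
    rewrite /h mulrACA -exprMn -expr2 sqr_sqrtr ?(ltW dl0)// /w -!expRD; congr (_ * expR _).
    rewrite /sqnorm /sqdist !mulr_sumr -!big_split/=.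
    by apply: eq_bigr => i _; rewrite tnth_mktuple /a; field.
  rewrite hE mulr1 /u mulrAC mulrCA ler_wpM2l ?mulr_ge0//.
  rewrite exprM expRM_natl -exprMn lerXn2r ?nnegrE ?mulr_ge0 ?expR_ge0 ?sqr_ge0 ?(ltW dl0)//.
  apply: le_trans (gaussian_mean_harnack mg g01 x y) _.
  by rewrite ler_wpM2r ?expR_ge0// Ddl//; move: yD; rewrite in_setE.
have Emu : measurable_fun setT (fun x => (u x)%:E) by exact/measurable_EFinP.
have Emv : measurable_fun setT (fun x => (v x)%:E) by exact/measurable_EFinP.
have Emh : measurable_fun setT (fun x => (h x)%:E) by exact/measurable_EFinP.
have Eu0 x : (0 <= (u x)%:E)%E by rewrite lee_fin.
have Ev0 x : (0 <= (v x)%:E)%E by rewrite lee_fin.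
have Eh0 x : (0 <= (h x)%:E)%E by rewrite lee_fin.
have := @prekopa_leindler R d (fun x => (u x)%:E) (fun x => (v x)%:E) (fun x => (h x)%:E)
  Emu Emv Emh Eu0 Ev0 Eh0 uvh.
rewrite (_ : \int[vol d]_x (h x)%:E =
    (Num.sqrt dl ^+ m * Num.sqrt (pi / (m%:R / 2)) ^+ d)%:E)%E; last first.
  by apply: integral_gaussZ; rewrite ?exprn_ge0// divr_gt0.
have Iu : ((b ^+ (2 * m) * Z)%:E <= \int[vol d]_x (u x)%:E)%E.
  have := @integral_gauss_power a b (2 * m).-1 a0 b0 Ib.
  by rewrite prednK// muln_gt0.
have Iv : ((expR (- a * r ^+ 2))%:E * vol d D <= \int[vol d]_x (v x)%:E)%E.
  rewrite -[D in vol d D]setIT -integral_indic//.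
  have mE : measurable_fun setT (fun x => (\1_D x)%:E : \bar R).
    by apply/measurable_EFinP; exact: measurable_indic.
  have c0 : (0 <= (expR (- a * r ^+ 2))%:E)%E by rewrite lee_fin expR_ge0.
  have E0 x : (0 <= (\1_D x)%:E :> \bar R)%E by rewrite lee_fin.
  rewrite -ge0_integralZl//.
  apply: ge0_le_integral => //.
  - exact: measurable_funeM.
  move=> x _; rewrite -EFinM lee_fin /v indicE.
  have [xD|xD] := boolP (x \in D); last by rewrite !mulr0.
  rewrite !mulr1 ler_expR !mulNr lerN2 ler_pM2l//.
  by have := Dr x; rewrite ball2E//=; apply; move: xD; rewrite in_setE.
set J := (_ * _)%E => PL.
have {PL}PL : ((4 ^+ d)%:E * ((b ^+ (2 * m) * Z)%:E * ((expR (- a * r ^+ 2))%:E * vol d D)) <=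
   (dl ^+ m * (4 ^+ d * Z * Z))%:E)%E.
  apply: (@le_trans _ _ J).
    rewrite lee_pmul2l ?lte_fin ?exprn_gt0//.
    by apply: lee_pmul => //; rewrite ?mule_ge0 ?lee_fin ?mulr_ge0 ?exprn_ge0 ?expR_ge0 ?(ltW Z0).
  apply: (le_trans PL); rewrite -EFinM lee_fin.
  rewrite mulrACA -!exprMn -!expr2 !sqr_sqrtr ?(ltW dl0) ?divr_ge0 ?(ltW pi0) ?(ltW mR0)//.
  rewrite -[4 * _ * _]mulrA -expr2 sqr_sqrtr ?divr_ge0 ?(ltW pi0) ?(ltW a0)//.
  rewrite ler_wpM2l ?exprn_ge0 ?(ltW dl0)//.
  by rewrite (_ : pi / _ = 4 * (pi / a))// /a; field; rewrite gt_eqF.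
pose q := 4 ^+ d * Z * expR (- a * r ^+ 2).
have q0 : 0 < q.
  apply: mulr_gt0; last exact: expR_gt0.
  by apply: mulr_gt0 => //; exact: exprn_gt0.
rewrite -(@lee_pmul2l _ q%:E)//.
rewrite (_ : q%:E * (_ * _) = (4 ^+ d)%:E * ((b ^+ (2 * m) * Z)%:E *
    ((expR (- a * r ^+ 2))%:E * vol d D)))%E; last first.
  by rewrite !muleA -!EFinM; congr (_%:E * _)%E; rewrite /q; ring.
apply: (le_trans PL); rewrite -EFinM lee_fin /q.
rewrite (_ : 4 ^+ d * Z * _ * _ = dl ^+ m * (4 ^+ d * Z * Z) *
  (expR (- a * r ^+ 2) * expR (a * r ^+ 2))); last by ring.
by rewrite -expRD mulNr addNr expR0 mulr1.
Qed.
End concentration.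

(** * The ratio of volumes in a fixed dimension *)

Section volume_ratio.
Context {R : realType}.

(** A lower bound for the average of the error of the second kind over the Gaussian
    prior, when eta bounds the error at 0 and C bounds r / d^(1/4). *)
Definition error_floor (C eta : R) : R := eta ^+ 2 * expR (- (C ^+ 4 / 2)).

(** The exponent is chosen so that the m-th power of the second factor outweighs
    exp((8 + 2 C^2) sqrt d), the loss between Gaussian and Lebesgue measure on the
    ball, using sqrt d <= 4 C^2 m, and leaves a factor exp(-2m) to spare. *)
Definition error_threshold (C eta : R) : R :=
  error_floor C eta ^+ 2 * expR (- ((8 + 2 * C ^+ 2) * (4 * C ^+ 2) + 2)).

Lemma error_floor_gt0 (C eta : R) : 0 < eta -> 0 < error_floor C eta.
Proof. by move=> e0; rewrite mulr_gt0 ?exprn_gt0 ?expR_gt0. Qed.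

Lemma error_threshold_gt0 (C eta : R) : 0 < eta -> 0 < error_threshold C eta.
Proof. by move=> e0; rewrite mulr_gt0 ?expR_gt0 ?exprn_gt0 ?error_floor_gt0. Qed.

Lemma lee_ratio (x y : \bar R) (K L : R) : (0 <= x)%E -> 0 < L ->
  (x <= K%:E)%E -> (L%:E <= y)%E -> (x / y <= (K / L)%:E)%E.
Proof.
move=> x0 L0 xK; have K0 : 0 <= K by rewrite -lee_fin (le_trans x0).
case: y => [v| |]//= Lv.
- rewrite lee_fin in Lv; have v0 : 0 < v by exact: lt_le_trans Lv.
  rewrite inver gt_eqF// EFinM; apply: lee_pmul => //; rewrite lee_fin ?invr_ge0 ?(ltW v0)//.
  by rewrite lef_pV2 ?posrE.
- by rewrite invey mule0 lee_fin divr_ge0// ltW.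
Qed.

(** The integer m is the least above (d/2 + 4 sqrt d)/(2 r^2).  It is large enough
    for the Gaussian shell to fit in the ball, which also gives 2m >= d/(2r^2), a
    bound on the exponent of the claim; and rounding up only adds 2r^2 = O(sqrt d) to 2m r^2. *)
Lemma volume_ratio_le d (g : d.-tuple R -> R) (C eta r : R) (D : set (d.-tuple R)) :
  (0 < d)%N -> measurable_fun setT g -> (forall y, 0 <= g y <= 1) ->
  0 < C -> 0 < eta -> eta <= gaussian_mean g [tuple 0 | i < d] ->
  0 < r -> r ^+ 2 <= C ^+ 2 * Num.sqrt d%:R ->
  measurable D -> D `<=` ball2 d r ->
  (forall x, D x -> gaussian_mean g x <= error_threshold C eta) ->
  (vol d D / vol d (ball2 d r) <=
    (2 * expR (- ((d%:R - 1) / (2 * r ^+ 2))))%:E)%E.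
Proof.
move=> d0 mg g01 C0 eta0 heta r0 hr mD Dr Dsmall.
set sd := Num.sqrt d%:R in hr.
have d1 : 1 <= d%:R :> R by rewrite (ler_nat _ 1).
have sd2 : sd ^+ 2 = d%:R by rewrite sqr_sqrtr// ler0n.
have sd0 : 0 < sd by rewrite sqrtr_gt0 ltr0n.
have r20 : 0 < r ^+ 2 by rewrite exprn_gt0.
pose X := (d%:R / 2 + 4 * sd) / (2 * r ^+ 2).
have X0 : 0 <= X by apply: divr_ge0; lra.
pose m := (Num.truncn X).+1.
have /andP[mX1 mX2] := truncn_itv X0.
have m0 : (0 < m)%N by [].
have mR0 : 0 < m%:R :> R by rewrite ltr0n.
have Xm : X <= m%:R by exact: ltW.
have mX : m%:R <= X + 1 by rewrite -natr1 lerD2r.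
pose a : R := 2 * m%:R.
have a0 : 0 < a by rewrite mulr_gt0.
have ar1 : d%:R / 2 + 4 * sd <= a * r ^+ 2.
  move: Xm; rewrite ler_pdivrMr ?mulr_gt0// /a; lra.
have ar2 : a * r ^+ 2 <= d%:R / 2 + 4 * sd + 2 * r ^+ 2.
  have : m%:R * (2 * r ^+ 2) <= (X + 1) * (2 * r ^+ 2) by apply: ler_wpM2r => //; lra.
  have : X * (2 * r ^+ 2) = d%:R / 2 + 4 * sd by rewrite /X divfK// gt_eqF// mulr_gt0.
  by rewrite /a; lra.
have da : d%:R <= a * (2 * r ^+ 2) by move: ar1; lra.
have C20 : 0 < C ^+ 2 by rewrite exprn_gt0.
(* As r^2 <= C^2 sqrt d, the error terms exp(O(sqrt d)) are exp(O(m)). *)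
have sdm : sd <= 4 * C ^+ 2 * m%:R.
  have : sd * sd <= sd * (4 * C ^+ 2 * m%:R).
    rewrite -expr2 sd2; apply: (le_trans da).
    have : m%:R * r ^+ 2 <= m%:R * (C ^+ 2 * sd) by rewrite ler_pM2l.
    by rewrite /a; lra.
  by rewrite ler_pM2l.
set Z := Num.sqrt (pi / a) ^+ d.
have Z0 : 0 < Z by rewrite exprn_gt0// sqrtr_gt0 divr_gt0// pi_gt0.
have mw : measurable_fun setT (fun x : d.-tuple R => expR (- a * sqnorm x)).
  exact: measurable_gauss_weight.
have ms := measurable_gaussian_mean mg g01.
have s0 := gaussian_mean_ge0 g01.
have s1 := gaussian_mean_le1 mg g01.
pose I := (\int[vol d]_x (expR (- a * sqnorm x) * gaussian_mean g x)%:E)%E.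
have Ipos : (0 <= I)%E.
  by apply: integral_ge0 => x _; rewrite lee_fin; exact: mulr_ge0 (expR_ge0 _) (s0 x).
have Ile : (I <= Z%:E)%E.
  rewrite -integral_gauss0//; apply: ge0_le_integral => //.
  - by move=> x _; rewrite lee_fin; exact: mulr_ge0 (expR_ge0 _) (s0 x).
  - by apply/measurable_EFinP; exact: measurable_funM.
  - exact/measurable_EFinP.
  - by move=> x _; rewrite lee_fin ler_piMr ?expR_ge0.
have Ifin : I \is a fin_num by rewrite ge0_fin_numE// (le_lt_trans Ile)// ltry.
pose b := fine I / Z.
have Ib : I = (b * Z)%:E by rewrite divfK ?gt_eqF// fineK.
have b0 : 0 <= b by rewrite divr_ge0 ?fine_ge0 ?(ltW Z0).
have floor_b : error_floor C eta <= b.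
  have H := gaussian_mean0_le mg g01 a0 Ib.
  have {}H : gaussian_mean g [tuple 0 | i < d] ^+ 2 <= b * expR (d%:R / (8 * a ^+ 2)).
    by rewrite -(ler_pM2r Z0); apply: (le_trans H); rewrite mulrAC.
  have H2 : eta ^+ 2 <= gaussian_mean g [tuple 0 | i < d] ^+ 2.
    by rewrite lerXn2r ?nnegrE ?(ltW eta0).
  have H3 : d%:R / (8 * a ^+ 2) <= C ^+ 4 / 2.
    rewrite ler_pdivrMr ?mulr_gt0 ?exprn_gt0//.
    have E1 : d%:R * d%:R <= d%:R * (a ^+ 2 * C ^+ 4 * 4).
      have Q2 : d%:R * d%:R <= (a * (2 * r ^+ 2)) * (a * (2 * r ^+ 2)).
        by apply: ler_pM => //; lra.
      have Q1 : r ^+ 2 * r ^+ 2 <= C ^+ 4 * d%:R.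
        rewrite (_ : C ^+ 4 * _ = (C ^+ 2 * sd) * (C ^+ 2 * sd)); last by rewrite -sd2; ring.
        by apply: ler_pM => //; exact: ltW.
      apply: (le_trans Q2).
      rewrite (_ : _ * _ = 4 * a ^+ 2 * (r ^+ 2 * r ^+ 2)); last by ring.
      rewrite (_ : d%:R * _ = 4 * a ^+ 2 * (C ^+ 4 * d%:R)); last by ring.
      by rewrite ler_wpM2l// mulr_ge0// sqr_ge0.
    have : d%:R <= a ^+ 2 * C ^+ 4 * 4 by rewrite -(ler_pM2l (lt_le_trans ltr01 d1)).
    lra.
  rewrite /error_floor expRN ler_pdivrMr ?expR_gt0//.
  apply: (le_trans H2); apply: (le_trans H).
  by rewrite ler_wpM2l// ler_expR.
have fl0 := error_floor_gt0 C eta0.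
have th0 := error_threshold_gt0 C eta0.
have b0' : 0 < b by exact: lt_le_trans floor_b.
have V := volume_gaussian_mean_small mg g01 m0 b0 (ltW r0) th0 Ib mD Dr Dsmall.
have B := ball_volume_ge d0 a0 (ltW r0) ar1.
rewrite -/a -/Z in V; rewrite -/Z -/sd in B.
pose M := (8 + 2 * C ^+ 2) * (4 * C ^+ 2) + 2.
have {}V : (vol d D <= (expR (- M * m%:R) * expR (a * r ^+ 2) * Z)%:E)%E.
  have bm : 0 < b ^+ (2 * m) by rewrite exprn_gt0.
  rewrite -(@lee_pmul2l _ (b ^+ (2 * m))%:E)//; apply: (le_trans V).
  rewrite -EFinM lee_fin !mulrA ler_wpM2r ?(ltW Z0)// ler_wpM2r ?expR_ge0//.
  rewrite [- M * _]mulrC expRM_natl exprM -exprMn.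
  have bM0 : 0 <= b ^+ 2 * expR (- M) by apply: mulr_ge0; rewrite ?sqr_ge0 ?expR_ge0.
  rewrite lerXn2r ?nnegrE ?(ltW th0)//.
  by rewrite /error_threshold -/M ler_wpM2r ?expR_ge0// lerXn2r ?nnegrE ?(ltW fl0).
apply: (le_trans (lee_ratio _ _ V B)) => //.
  by rewrite mulr_gt0 ?mulr_gt0 ?expR_gt0.
rewrite lee_fin.
rewrite [leLHS](_ : _ = 3 / 2 * expR (- M * m%:R + a * r ^+ 2 - (d%:R / 2 - 4 * sd))); last first.
  rewrite (expRD (- M * m%:R + a * r ^+ 2)) (expRD (- M * m%:R)).
  rewrite (expRN (d%:R / 2 - 4 * sd)); field.
  by rewrite !gt_eqF ?expR_gt0.
apply: ler_pM; rewrite ?expR_ge0//; first by lra.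
rewrite ler_expR.
have Q1 : (d%:R - 1) / (2 * r ^+ 2) <= a.
  by rewrite ler_pdivrMr ?mulr_gt0//; move: da; lra.
have Q2 : (8 + 2 * C ^+ 2) * sd <= (8 + 2 * C ^+ 2) * (4 * C ^+ 2 * m%:R).
  by rewrite ler_wpM2l// addr_ge0// mulr_ge0 ?(ltW C20).
have Q3 : M * m%:R = (8 + 2 * C ^+ 2) * (4 * C ^+ 2 * m%:R) + a by rewrite /M /a; ring.
rewrite mulNr; move: Q1 Q2 Q3 ar2 hr; lra.
Qed.
End volume_ratio.

(** * Asymptotics *)

Section error.
Context {R : realType} {dO : measure_display} {Omega : measurableType dO}.
Variables (P : probability Omega R) (eps : nat -> {RV P >-> R}).
Hypothesis heps : iid_standard_normal eps.

Lemma expectation_test d (psi : d.-tuple R -> R) (th : d.-tuple R) : is_test psi ->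
  ('E_P[fun w => psi (tuple_add th (noise eps d w))] =
   (1 - gaussian_mean (fun y => 1 - psi y) th)%:E)%E.
Proof.
move=> [mpsi psi01].
have psi0 y : 0 <= psi y by case/andP: (psi01 y).
have g01 y : 0 <= 1 - psi y <= 1.
  by have /andP[h1 h2] := psi01 y; apply/andP; split; lra.
have mg : measurable_fun setT (fun y => 1 - psi y) by exact: measurable_funB.
rewrite (expectation_noise heps th mpsi psi0).
have mpdf := @measurable_gaussian_pdf R d th.
have pdf0 := @gaussian_pdf_ge0 R d th.
have F1 y : (0 <= (psi y * gaussian_pdf th y)%:E)%E by rewrite lee_fin mulr_ge0.
have F2 y : (0 <= ((1 - psi y) * gaussian_pdf th y)%:E)%E.
  by rewrite lee_fin mulr_ge0//; case/andP: (g01 y).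
have mF1 : measurable_fun setT (fun y => (psi y * gaussian_pdf th y)%:E).
  by apply/measurable_EFinP; exact: measurable_funM.
have mF2 : measurable_fun setT (fun y => ((1 - psi y) * gaussian_pdf th y)%:E).
  by apply/measurable_EFinP; exact: measurable_funM.
have S : (\int[vol d]_y (psi y * gaussian_pdf th y)%:E +
    (gaussian_mean (fun y => 1 - psi y) th)%:E = 1)%E.
  rewrite (gaussian_meanE mg g01) -ge0_integralD// -(integral_gaussian_pdf th).
  by apply: eq_integral => y _; rewrite -EFinD -mulrDl addrCA subrr addr0 mul1r.
by rewrite EFinB -S addeK.
Qed.

Lemma noise_as_shift d w : noise eps d w = tuple_add [tuple 0 | i < d] (noise eps d w).
Proof. by apply: eq_from_tnth => i; rewrite !tnth_mktuple add0r. Qed.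

End error.

Lemma sqr_powR_quarter (R : realType) (d : nat) :
  (d%:R `^ 4^-1 : R) ^+ 2 = Num.sqrt d%:R.
Proof.
rewrite -powR_mulrn ?powR_ge0// -powRrM (_ : 4^-1 * 2%:R = 2^-1); last by field.
by rewrite powR12_sqrt// ler0n.
Qed.

Lemma bounded_radius (R : realType) (r : nat -> R) :
  (forall d : nat, (0 < d)%N -> 0 < r d) ->
  [bounded r d / d%:R `^ 4^-1 | d in [set d : nat | (0 < d)%N]] ->
  exists2 C : R, 0 < C & forall d, (0 < d)%N -> r d ^+ 2 <= C ^+ 2 * Num.sqrt d%:R.
Proof.
move=> hr [M [_ HM]].
exists (`|M| + 1); first by rewrite ltr_wpDl.
move=> d d0; have := HM (`|M| + 1) (le_lt_trans (ler_norm M) _).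
rewrite ltrDl ltr01 => /(_ isT d d0) /=.
have q0 : 0 < d%:R `^ 4^-1 :> R by apply: powR_gt0; rewrite ltr0n.
rewrite ger0_norm ?divr_ge0 ?(ltW (hr _ d0)) ?(ltW q0)// ler_pdivrMr// => H.
rewrite -sqr_powR_quarter -exprMn lerXn2r ?nnegrE ?(ltW (hr _ d0))//.
Qed.

(** As r^2 = O(sqrt d), the exponent is at least of order sqrt d. *)
Lemma cvg_expR_radius (R : realType) (r : nat -> R) (C : R) : 0 < C ->
  (forall d : nat, (0 < d)%N -> 0 < r d) ->
  (forall d, (0 < d)%N -> r d ^+ 2 <= C ^+ 2 * Num.sqrt d%:R) ->
  (2 * expR (- ((d%:R - 1) / (2 * r d ^+ 2)))) @[d --> \oo] --> (0 : R).
Proof.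
move=> C0 hr hC.
have C20 : 0 < 4 * C ^+ 2 by rewrite mulr_gt0 ?exprn_gt0.
have lim : (2 * expR (- (Num.sqrt d%:R / (4 * C ^+ 2)))) @[d --> \oo] --> (0 : R).
  rewrite -[0](mulr0 2); apply: cvgMr.
  apply: (cvg_comp (fun d : nat => Num.sqrt d%:R / (4 * C ^+ 2)) (fun x : R => expR (- x)));
    last exact: cvgr_expR.
  apply/cvgryPge => A; near=> d.
  rewrite ler_pdivlMr//.
  apply: (le_trans (ler_norm _)); rewrite -sqrtr_sqr ler_sqrt ?ler0n//.
  by near: d; exact: nbhs_infty_ger.
apply: (squeeze_cvgr _ (cvg_cst 0) lim).
near=> d.
have d2 : 2 <= d%:R :> R by near: d; exact: nbhs_infty_ger.
have d0 : (0 < d)%N by rewrite -(ltr_nat R); lra.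
rewrite mulr_ge0 ?expR_ge0//= ler_pM2l// ler_expR lerN2.
have r20 : 0 < r d ^+ 2 by apply: exprn_gt0; exact: hr.
have sd0 : 0 < Num.sqrt d%:R :> R by rewrite sqrtr_gt0; lra.
have r2' : 0 < 2 * r d ^+ 2 by lra.
rewrite ler_pdivrMr// mulrAC ler_pdivlMr//.
have := hC d d0; rewrite -(ler_pM2l sd0) => H.
have E : Num.sqrt d%:R * (C ^+ 2 * Num.sqrt d%:R) = C ^+ 2 * d%:R :> R.
  by rewrite mulrCA -expr2 sqr_sqrtr//; lra.
rewrite E in H.
have H2 : C ^+ 2 * d%:R <= C ^+ 2 * (2 * (d%:R - 1)) by rewrite ler_pM2l ?exprn_gt0//; lra.
by lra.
Unshelve. all: by end_near. Qed.

(** The array theta picks in each dimension a point of D with error above dl whenever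
    there is one.  It lies in the product of the D d, so the tests are
    consistent against it, and its points cannot be bad for large d. *)
Lemma eventually_small_error (R : realType) (dO : measure_display)
    (Omega : measurableType dO) (P : probability Omega R)
    (eps : nat -> {RV P >-> R}) (heps : iid_standard_normal eps)
    (psi : forall d : nat, d.-tuple R -> R)
    (hpsi : forall d : nat, (0 < d)%N -> is_test (psi d))
    (D : forall d : nat, set (d.-tuple R)) (dl : R) :
  (forall d : nat, (0 < d)%N -> D d !=set0) -> 0 < dl ->
  product_set D `<=` consistency_set eps psi ->
  \forall d \near \oo, forall th, D d th -> gaussian_mean (fun y => 1 - psi d y) th <= dl.
Proof.
move=> D0 dl0 DC.
pose bad d th := D d th /\ dl < gaussian_mean (fun y => 1 - psi d y) th.
have H d : exists th : d.-tuple R, ((0 < d)%N -> D d th) /\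
    ((exists th', bad d th') -> bad d th).
  have [[th [Dth hth]]|nobad] := pselect (exists th, bad d th).
    by exists th; split.
  have [d0|d0] := boolP (0 < d)%N; last first.
    by exists [tuple 0 | i < d]; split => // /(elimN idP d0).
  by have [th Dth] := D0 d d0; exists th; split.
pose theta d := projT1 (cid (H d)).
have thetaP d := projT2 (cid (H d)).
have : consistency_set eps psi theta by apply: DC => d d0; have [h _] := thetaP d; exact: h.
rewrite /consistency_set/= /consistent => /fine_cvgP[_ /cvgr_gt].
move=> /(_ (1 - dl)); rewrite ltrBlDr ltrDl => /(_ dl0) near_small.
near=> d => th Dth; rewrite leNgt; apply/negP => hth.
have d0 : (0 < d)%N by near: d; exact: nbhs_infty_gt.
have [_ hbad] := thetaP d.
have [_ hth'] := hbad (ex_intro _ th (conj Dth hth)).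
have : 1 - dl < fine ('E_P[fun w => psi d (tuple_add (theta d) (noise eps d w))])%E.
  by near: d.
by rewrite (expectation_test heps (theta d) (hpsi d d0))/= -/(theta d) in hth' *; lra.
Unshelve. all: by end_near. Qed.

Unset Implicit Arguments.
Theorem theorem5p1 (R : realType) (dO : measure_display)
    (Omega : measurableType dO) (P : probability Omega R)
    (eps : nat -> {RV P >-> R}) (heps : iid_standard_normal eps)
    (psi : forall d : nat, d.-tuple R -> R)
    (hpsi : forall d : nat, (0 < d)%N -> is_test (psi d))
    (alpha : R) (halpha : 0 < alpha < 1)
    (hsize : has_asymptotic_size eps psi alpha)
    (r : nat -> R) (hr : forall d : nat, (0 < d)%N -> 0 < r d)
    (hbounded : [bounded r d / d%:R `^ 4^-1 | d in [set d : nat | (0 < d)%N]]) :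
  exists2 e : R, 0 < e &
    forall D : (forall d : nat, set (d.-tuple R)),
      (forall d : nat, (0 < d)%N ->
        [/\ D d !=set0, measurable (D d) & D d `<=` ball2 d (r d)]) ->
      product_set D `<=` consistency_set eps psi ->
      (\forall d \near \oo,
        (vol d (D d) / vol d (ball2 d (r d)) <=
          (2 * expR (- (e ^+ 2 * (d%:R - 1) / (2 * r d ^+ 2))))%:E)%E) /\
      (vol d (D d) / vol d (ball2 d (r d)))%E @[d --> \oo] --> 0%E.
Proof.
have [C C0 hC] := bounded_radius hr hbounded.
pose eta := (1 - alpha) / 2.
have eta0 : 0 < eta by case/andP: halpha; rewrite /eta; lra.
exists 1 => // D hD DC.
have bound : \forall d \near \oo, (vol d (D d) / vol d (ball2 d (r d)) <=
    (2 * expR (- ((d%:R - 1) / (2 * r d ^+ 2))))%:E)%E.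
  have small := eventually_small_error heps hpsi
    (fun d d0 => let: And3 h _ _ := hD d d0 in h) (error_threshold_gt0 C eta0) DC.
  have null : \forall d \near \oo,
      eta <= gaussian_mean (fun y => 1 - psi d y) [tuple 0 | i < d].
    move: hsize => /fine_cvgP[_ /cvgr_lt] /(_ ((1 + alpha) / 2)) hs.
    have ha : alpha < (1 + alpha) / 2 by case/andP: halpha; lra.
    near=> d; have d0 : (0 < d)%N by near: d; exact: nbhs_infty_gt.
    have : fine ('E_P[fun w => psi d (noise eps d w)])%E < (1 + alpha) / 2.
      by near: d; exact: hs.
    under eq_fun do rewrite noise_as_shift.
    by rewrite (expectation_test heps _ (hpsi d d0))/= /eta; lra.
  near=> d; have d0 : (0 < d)%N by near: d; exact: nbhs_infty_gt.
  have [_ mD Dr] := hD d d0.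
  have [mpsi psi01] := hpsi d d0.
  apply: (@volume_ratio_le R d (fun y => 1 - psi d y) C eta) => //.
  - exact: measurable_funB.
  - by move=> y; have /andP[h1 h2] := psi01 y; apply/andP; split; lra.
  - by near: d.
  - exact: hr.
  - exact: hC.
  - by near: d.
split.
  by near do rewrite expr1n mul1r.
apply: (@squeeze_cvge _ _ _ _ (cst 0%E) _
    (fun d => (2 * expR (- ((d%:R - 1) / (2 * r d ^+ 2))))%:E)).
- near=> d; apply/andP; split; last by near: d.
  by rewrite mule_ge0// inve_ge0.
- exact: cvg_cst.
- by apply/fine_cvgP; split; [exact: nearW|exact: (cvg_expR_radius C0 hr hC)].
Unshelve. all: by end_near. Qed.
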